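(* Let $\mathbf{D}$ be a locally small dagger rig category satisfying axioms (A1)–(A10) listed in the context, let $\mathcal{C}$ be the involutive field of scalars of its scalar localisation $\mathbf{C}$, and let $\mathcal{R}_+\subseteq\mathcal{C}$ be the set of positive scalars. There is an isomorphism of $\mathcal{C}$ with $\mathbb{R}$ or $\mathbb{C}$ that maps $\mathcal{R}_+$ onto $\mathbb{R}_+=\{r\in\mathbb{R}:r\ge0\}$.
   Context: Dagger categories. A dagger on a category is a contravariant endofunctor $(-)^\dagger$ with $X^\dagger=X$ and $f^{\dagger\dagger}=f$. A morphism $f$ is a dagger monomorphism if $f^\dagger f=1$, a dagger epimorphism if $ff^\dagger=1$, a dagger isomorphism if both. A dagger symmetric monoidal category is a symmetric monoidal category with a dagger whose monoidal product is a dagger functor (preserves $\dagger$) and whose symmetry, associator and unitors are dagger isomorphisms. A dagger rig category is a dagger category with dagger symmetric monoidal structures $(\otimes,I)$ and $(\oplus,O)$ and natural dagger isomorphisms $A\otimes(X\oplus Y)\to(A\otimes X)\oplus(A\otimes Y)$, $(X\oplus Y)\otimes A\to(X\otimes A)\oplus(Y\otimes A)$, $X\otimes O\to O$, $O\otimes X\to O$, satisfying Laplaza's coherence conditions for rig (symmetric bimonoidal) categories, which amount to the following. Write $\alpha,\lambda,\rho,\sigma$ for the associator $(A\otimes B)\otimes C\to A\otimes(B\otimes C)$, left unitor $I\otimes A\to A$, right unitor $A\otimes I\to A$ and symmetry of $\otimes$, write $\alpha',\lambda',\rho',\sigma'$ for those of $\oplus$, write $\delta_{A,X,Y},\varepsilon_{X,Y,A},\xi_X,\zeta_X$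 for the four isomorphisms just listed, in that order, and write $\tau_{W,X,Y,Z}\colon(W\oplus X)\oplus(Y\oplus Z)\to(W\oplus Y)\oplus(X\oplus Z)$ for the canonical interchange isomorphism built from $\alpha'$ and $\sigma'$. Then, for all objects $A,B,C,D$ (abbreviating $A\otimes B$ to $AB$): $\sigma'_{AB,AC}\,\delta_{A,B,C}=\delta_{A,C,B}(1_A\otimes\sigma'_{B,C})$; $(\sigma_{A,C}\oplus\sigma_{B,C})\varepsilon_{A,B,C}=\delta_{C,A,B}\,\sigma_{A\oplus B,C}$; $\alpha'_{AB,AC,AD}(\delta_{A,B,C}\oplus1_{AD})\delta_{A,B\oplus C,D}=(1_{AB}\oplus\delta_{A,C,D})\delta_{A,B,C\oplus D}(1_A\otimes\alpha'_{B,C,D})$; $\delta_{A,BC,BD}(1_A\otimes\delta_{B,C,D})\alpha_{A,B,C\oplus D}=(\alpha_{A,B,C}\oplus\alpha_{A,B,D})\delta_{AB,C,D}$; $\tau_{AC,BC,AD,BD}(\varepsilon_{A,B,C}\oplus\varepsilon_{A,B,D})\delta_{A\oplus B,C,D}=(\delta_{A,C,D}\oplus\delta_{B,C,D})\varepsilon_{A,B,C\oplus D}$; $\zeta_O=\xi_O$; $\zeta_{A\oplus B}=\lambda'_O(\zeta_A\oplus\zeta_B)\delta_{O,A,B}$; $\zeta_I=\rho_O$; $\xi_A\,\sigma_{O,A}=\zeta_A$; $\zeta_{AB}\,\alpha_{O,A,B}=\zeta_B(\zeta_A\otimes1_B)$; $\lambda'_{AB}(\xi_A\oplus1_{AB})\delta_{A,O,B}=1_A\otimes\lambda'_B$;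 $(\lambda_A\oplus\lambda_B)\delta_{I,A,B}=\lambda_{A\oplus B}$ (the remaining conditions on Laplaza's list follow from these). Axioms. (A1) $O$ is terminal (hence a zero object; write $0$ for zero morphisms, $i_1\colon X\cong X\oplus O\xrightarrow{1\oplus0}X\oplus Y$, $i_2\colon Y\cong O\oplus Y\xrightarrow{0\oplus1}X\oplus Y$, $p_k=i_k^\dagger$). (A2) $i_1,i_2$ are jointly epic. (A3) There is $d\colon I\to I\oplus I$ with $i_1^\dagger d\ne0\ne i_2^\dagger d$. (A4) Exactly two subobjects of $I$ have a dagger monic representative. (A5) If $f,g\colon X\otimes Y\to Z$ satisfy $f(x\otimes y)=g(x\otimes y)$ for all $x\colon I\to X$, $y\colon I\to Y$, then $f=g$. (A6) Every parallel pair has an equaliser that is a dagger monomorphism. (A7) Every dagger monomorphism is a kernel. (A8) For all epimorphisms $x\colon A\to X$, $y\colon A\to Y$: $x^\dagger x=y^\dagger y$ if and only if $y=fx$ for some isomorphism $f\colon X\to Y$. (A9) Every bounded sequential diagram has a colimit, where a sequential diagram is one generated by a sequence $X_1\xrightarrow{f_1}X_2\xrightarrow{f_2}\cdots$, and it is bounded if it has a cocone of monomorphisms. (A10) Every object $X$ is dagger finite: each $f\colon X\to X$ with $f^\dagger f=1$ satisfies $ff^\dagger=1$. The localisation $U\colon\mathbf{D}\to\mathbf{C}$. For $a\colon I\to I$ and $f\colon X\to Y$ in $\mathbf{D}$, let $a\cdot f=(X\cong I\otimes X\xrightarrow{a\otimes f}I\otimes Y\cong Y)$. The category $\mathbf{C}$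 has the same objects as $\mathbf{D}$; its morphisms $X\to Y$ are equivalence classes $f/a$ of pairs $(f,a)$ with $f\colon X\to Y$ and $0\ne a\colon I\to I$ in $\mathbf{D}$, where $(f,a)\simeq(g,b)$ iff $b\cdot f=a\cdot g$; composition is $(g/b)(f/a)=(gf)/(ba)$; the dagger is $(f/a)^\dagger=f^\dagger/a^\dagger$; and $\frac fa\otimes\frac gb=\frac{f\otimes g}{ab}$, $\frac fa\oplus\frac gb=\frac{b\cdot f\oplus a\cdot g}{ab}$. $U$ is the identity on objects and $f\mapsto f/1$ on morphisms. In $\mathbf{C}$, $O$ is a zero object and $X\oplus Y$ with $i_1,i_2,p_1,p_2$ is a dagger biproduct, so hom-sets carry an addition, and $\mathcal{C}=\mathbf{C}(I,I)$ is an involutive field of characteristic zero (multiplication is composition, involution is $\dagger$). Positive scalars. $\mathcal{R}_+$ is the set of all $x^\dagger x\in\mathcal{C}$ with $x\colon I\to X$ a morphism of $\mathbf{C}$, $X$ any object. $\mathbb{R}$ and $\mathbb{C}$ are involutive fields with trivial involution and complex conjugation, respectively; the isomorphism is one of involutive fields. *)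

(* Defs.v *)
From HB Require Import structures.
From mathcomp Require Import all_boot all_order all_algebra.
From mathcomp Require Import boolp classical_sets reals.
From mathcomp Require Import complex.

Set Implicit Arguments.
Unset Strict Implicit.
Unset Printing Implicit Defensive.

Local Open Scope quotient_scope.

Declare Scope cat_scope.
Delimit Scope cat_scope with cat.
Local Open Scope cat_scope.

(* Local smallness is built in: the homs form a family of types in one
   universe, independent of the universe of the objects. *)
Record category := Category {
  Ob :> Type;
  hom : Ob -> Ob -> Type;
  hid : forall X, hom X X;
  hcomp : forall X Y Z, hom Y Z -> hom X Y -> hom X Z;
  hcompA : forall X Y Z W (h : hom Z W) (g : hom Y Z) (f : hom X Y),
    hcomp h (hcomp g f) = hcomp (hcomp h g) f;
  hcomp1f : forall X Y (f : hom X Y), hcomp (hid Y) f = f;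
  hcompf1 : forall X Y (f : hom X Y), hcomp f (hid X) = f }.

Arguments hom {c} X Y.
Arguments hid {c} X.
Arguments hcomp {c X Y Z} g f.

Notation "g ∘ f" := (hcomp g f) (at level 40, left associativity) : cat_scope.
Notation "\1_ X" := (hid X) (at level 8, X at level 2, format "\1_ X") : cat_scope.

Record dagger_category := DaggerCategory {
  dcat :> category;
  dag : forall X Y : dcat, hom X Y -> hom Y X;
  dag1 : forall X : dcat, dag \1_X = \1_X;
  dagM : forall (X Y Z : dcat) (g : hom Y Z) (f : hom X Y),
    dag (g ∘ f) = dag f ∘ dag g;
  dagK : forall (X Y : dcat) (f : hom X Y), dag (dag f) = f }.

Arguments dag {d X Y} f.
Notation "f '†'" := (dag f) (at level 2, left associativity, format "f '†'") : cat_scope.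

Section Morphisms.
Variable C : category.
Implicit Types X Y Z : C.

Definition monic X Y (m : hom X Y) :=
  forall Z (f g : hom Z X), m ∘ f = m ∘ g -> f = g.

Definition epic X Y (e : hom X Y) :=
  forall Z (f g : hom Y Z), f ∘ e = g ∘ e -> f = g.

Definition is_iso X Y (f : hom X Y) :=
  exists g : hom Y X, g ∘ f = \1_X /\ f ∘ g = \1_Y.

Definition terminal (T : C) :=
  forall X, exists f : hom X T, forall g : hom X T, g = f.

Definition equaliser E X Y (e : hom E X) (f g : hom X Y) :=
  f ∘ e = g ∘ e /\
  forall Z (h : hom Z X), f ∘ h = g ∘ h ->
    exists u : hom Z E, e ∘ u = h /\ forall v : hom Z E, e ∘ v = h -> v = u.

Definition same_subobject A B X (m : hom A X) (n : hom B X) :=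
  exists2 u : hom A B, is_iso u & m = n ∘ u.

Definition cocone (X : nat -> C) (f : forall n, hom (X n) (X n.+1))
    (Y : C) (c : forall n, hom (X n) Y) :=
  forall n, c n.+1 ∘ f n = c n.

Definition bounded_seq (X : nat -> C) (f : forall n, hom (X n) (X n.+1)) :=
  exists (Y : C) (c : forall n, hom (X n) Y),
    cocone f c /\ forall n, monic (c n).

Definition has_colimit (X : nat -> C) (f : forall n, hom (X n) (X n.+1)) :=
  exists (L : C) (l : forall n, hom (X n) L), cocone f l /\
    forall (Y : C) (c : forall n, hom (X n) Y), cocone f c ->
      exists u : hom L Y, (forall n, u ∘ l n = c n) /\
        forall v : hom L Y, (forall n, v ∘ l n = c n) -> v = u.

End Morphisms.

Section DaggerMorphisms.
Variable C : dagger_category.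
Implicit Types X Y : C.

Definition dagger_mono X Y (f : hom X Y) := f† ∘ f = \1_X.

Definition dagger_iso X Y (f : hom X Y) :=
  f† ∘ f = \1_X /\ f ∘ f† = \1_Y.

Definition has_dagger_mono_rep A X (m : hom A X) :=
  exists (B : C) (n : hom B X), dagger_mono n /\ same_subobject m n.

Definition exactly_two_dagger_subobjects X :=
  exists (A1 A2 : C) (m1 : hom A1 X) (m2 : hom A2 X),
    [/\ monic m1 /\ has_dagger_mono_rep m1,
        monic m2 /\ has_dagger_mono_rep m2,
        ~ same_subobject m1 m2 &
        forall (A : C) (m : hom A X), monic m -> has_dagger_mono_rep m ->
          same_subobject m m1 \/ same_subobject m m2].

Definition dagger_finite X :=
  forall f : hom X X, f† ∘ f = \1_X -> f ∘ f† = \1_X.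

End DaggerMorphisms.

Record dagger_smc (C : dagger_category) := DaggerSMC {
  mob : C -> C -> C;
  munit : C;
  mmor : forall (X X' Y Y' : C),
    hom X X' -> hom Y Y' -> hom (mob X Y) (mob X' Y');
  mmor1 : forall X Y : C, mmor \1_X \1_Y = \1_(mob X Y);
  mmorM : forall (X X' X'' Y Y' Y'' : C)
      (f' : hom X' X'') (f : hom X X') (g' : hom Y' Y'') (g : hom Y Y'),
    mmor (f' ∘ f) (g' ∘ g) = mmor f' g' ∘ mmor f g;
  mmor_dag : forall (X X' Y Y' : C) (f : hom X X') (g : hom Y Y'),
    (mmor f g)† = mmor (f†) (g†);
  massoc : forall A B C', hom (mob (mob A B) C') (mob A (mob B C'));
  mlunit : forall A, hom (mob munit A) A;
  mrunit : forall A, hom (mob A munit) A;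
  msym : forall A B, hom (mob A B) (mob B A);
  massoc_nat : forall (A A' B B' C' C'' : C)
      (f : hom A A') (g : hom B B') (h : hom C' C''),
    massoc A' B' C'' ∘ mmor (mmor f g) h = mmor f (mmor g h) ∘ massoc A B C';
  mlunit_nat : forall (A A' : C) (f : hom A A'),
    mlunit A' ∘ mmor \1_munit f = f ∘ mlunit A;
  mrunit_nat : forall (A A' : C) (f : hom A A'),
    mrunit A' ∘ mmor f \1_munit = f ∘ mrunit A;
  msym_nat : forall (A A' B B' : C) (f : hom A A') (g : hom B B'),
    msym A' B' ∘ mmor f g = mmor g f ∘ msym A B;
  massoc_iso : forall A B C', dagger_iso (massoc A B C');
  mlunit_iso : forall A, dagger_iso (mlunit A);
  mrunit_iso : forall A, dagger_iso (mrunit A);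
  msym_iso : forall A B, dagger_iso (msym A B);
  msymK : forall A B, msym B A ∘ msym A B = \1_(mob A B);
  mpentagon : forall A B C' D',
    massoc A B (mob C' D') ∘ massoc (mob A B) C' D' =
    mmor \1_A (massoc B C' D') ∘ massoc A (mob B C') D' ∘
      mmor (massoc A B C') \1_D';
  mtriangle : forall A B,
    mmor \1_A (mlunit B) ∘ massoc A munit B = mmor (mrunit A) \1_B;
  mhexagon : forall A B C',
    massoc B C' A ∘ msym A (mob B C') ∘ massoc A B C' =
    mmor \1_B (msym A C') ∘ massoc B A C' ∘ mmor (msym A B) \1_C' }.

Arguments mob {C} M A B : rename.
Arguments munit {C} M : rename.
Arguments mmor {C} M {X X' Y Y'} f g : rename.
Arguments massoc {C} M A B C' : rename.
Arguments mlunit {C} M A : rename.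
Arguments mrunit {C} M A : rename.
Arguments msym {C} M A B : rename.

(* The associator being a dagger isomorphism, its inverse is its dagger. *)
Definition interchange (C : dagger_category) (M : dagger_smc C) (W X Y Z : C) :
    hom (mob M (mob M W X) (mob M Y Z)) (mob M (mob M W Y) (mob M X Z)) :=
  (massoc M W Y (mob M X Z))† ∘
  mmor M \1_W (massoc M Y X Z ∘ mmor M (msym M X Y) \1_Z ∘ (massoc M X Y Z)†) ∘
  massoc M W X (mob M Y Z).

(* [distl], [distr], [annr], [annl] are Laplaza's delta, epsilon, xi, zeta. *)
Record rig_data := RigData {
  rcat :> dagger_category;
  otimes : dagger_smc rcat;
  oplus : dagger_smc rcat;
  distl : forall A X Y : rcat,
    hom (mob otimes A (mob oplus X Y)) (mob oplus (mob otimes A X) (mob otimes A Y));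
  distr : forall X Y A : rcat,
    hom (mob otimes (mob oplus X Y) A) (mob oplus (mob otimes X A) (mob otimes Y A));
  annr : forall X : rcat, hom (mob otimes X (munit oplus)) (munit oplus);
  annl : forall X : rcat, hom (mob otimes (munit oplus) X) (munit oplus) }.

Arguments otimes {r}.
Arguments oplus {r}.
Arguments distl {r} A X Y.
Arguments distr {r} X Y A.
Arguments annr {r} X.
Arguments annl {r} X.

Notation II := (munit otimes).
Notation OO := (munit oplus).
Notation "A ⊗ B" := (mob otimes A B) (at level 38, left associativity) : cat_scope.
Notation "A ⊕ B" := (mob oplus A B) (at level 39, left associativity) : cat_scope.
Notation "f ⊗ₘ g" := (mmor otimes f g) (at level 38, left associativity) : cat_scope.
Notation "f ⊕ₘ g" := (mmor oplus f g) (at level 39, left associativity) : cat_scope.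

Record is_dagger_rig (D : rig_data) : Prop := IsDaggerRig {
  distl_iso : forall A X Y : D, dagger_iso (distl A X Y);
  distr_iso : forall X Y A : D, dagger_iso (distr X Y A);
  annr_iso : forall X : D, dagger_iso (annr X);
  annl_iso : forall X : D, dagger_iso (annl X);
  distl_nat : forall (A A' X X' Y Y' : D)
      (a : hom A A') (f : hom X X') (g : hom Y Y'),
    distl A' X' Y' ∘ (a ⊗ₘ (f ⊕ₘ g)) = ((a ⊗ₘ f) ⊕ₘ (a ⊗ₘ g)) ∘ distl A X Y;
  distr_nat : forall (A A' X X' Y Y' : D)
      (a : hom A A') (f : hom X X') (g : hom Y Y'),
    distr X' Y' A' ∘ ((f ⊕ₘ g) ⊗ₘ a) = ((f ⊗ₘ a) ⊕ₘ (g ⊗ₘ a)) ∘ distr X Y A;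
  annr_nat : forall (X X' : D) (f : hom X X'),
    annr X' ∘ (f ⊗ₘ \1_OO) = annr X;
  annl_nat : forall (X X' : D) (f : hom X X'),
    annl X' ∘ (\1_OO ⊗ₘ f) = annl X;
  distl_sym : forall A B C : D,
    msym oplus (A ⊗ B) (A ⊗ C) ∘ distl A B C =
    distl A C B ∘ (\1_A ⊗ₘ msym oplus B C);
  distr_sym : forall A B C : D,
    (msym otimes A C ⊕ₘ msym otimes B C) ∘ distr A B C =
    distl C A B ∘ msym otimes (A ⊕ B) C;
  distl_plusA : forall A B C E : D,
    massoc oplus (A ⊗ B) (A ⊗ C) (A ⊗ E) ∘ (distl A B C ⊕ₘ \1_(A ⊗ E)) ∘
      distl A (B ⊕ C) E =
    (\1_(A ⊗ B) ⊕ₘ distl A C E) ∘ distl A B (C ⊕ E) ∘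
      (\1_A ⊗ₘ massoc oplus B C E);
  distl_tensA : forall A B C E : D,
    distl A (B ⊗ C) (B ⊗ E) ∘ (\1_A ⊗ₘ distl B C E) ∘ massoc otimes A B (C ⊕ E) =
    (massoc otimes A B C ⊕ₘ massoc otimes A B E) ∘ distl (A ⊗ B) C E;
  dist_interchange : forall A B C E : D,
    interchange oplus (A ⊗ C) (B ⊗ C) (A ⊗ E) (B ⊗ E) ∘
      (distr A B C ⊕ₘ distr A B E) ∘ distl (A ⊕ B) C E =
    (distl A C E ⊕ₘ distl B C E) ∘ distr A B (C ⊕ E);
  annl_O : annl (OO : D) = annr OO;
  annl_plus : forall A B : D,
    annl (A ⊕ B) = mlunit oplus OO ∘ (annl A ⊕ₘ annl B) ∘ distl OO A B;
  annl_I : annl (II : D) = mrunit otimes OO;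
  annr_sym : forall A : D, annr A ∘ msym otimes OO A = annl A;
  annl_tens : forall A B : D,
    annl (A ⊗ B) ∘ massoc otimes OO A B = annl B ∘ (annl A ⊗ₘ \1_B);
  distl_annr : forall A B : D,
    mlunit oplus (A ⊗ B) ∘ (annr A ⊕ₘ \1_(A ⊗ B)) ∘ distl A OO B =
    \1_A ⊗ₘ mlunit oplus B;
  distl_I : forall A B : D,
    (mlunit otimes A ⊕ₘ mlunit otimes B) ∘ distl II A B = mlunit otimes (A ⊕ B) }.

Record dagger_rig := DaggerRig {
  rdata :> rig_data;
  rigP : is_dagger_rig rdata }.

Section Zero.
Variables (D : dagger_rig) (hO : terminal (OO : D)).
Implicit Types X Y : D.

Definition bang X : hom X OO := projT1 (cid (hO X)).

Definition hzero X Y : hom X Y := (bang Y)† ∘ bang X.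

Definition inj1 X Y : hom X (X ⊕ Y) :=
  (\1_X ⊕ₘ hzero OO Y) ∘ (mrunit oplus X)†.

Definition inj2 X Y : hom Y (X ⊕ Y) :=
  (hzero OO X ⊕ₘ \1_Y) ∘ (mlunit oplus Y)†.

Definition prj1 X Y : hom (X ⊕ Y) X := (inj1 X Y)†.

Definition prj2 X Y : hom (X ⊕ Y) Y := (inj2 X Y)†.

Definition is_kernel E X Y (e : hom E X) (f : hom X Y) :=
  equaliser e f (hzero X Y).

End Zero.

Record rig_axioms (D : dagger_rig) : Prop := RigAxioms {
  O_terminal : terminal (OO : D);
  inj_jointly_epic : forall (X Y Z : D) (f g : hom (X ⊕ Y) Z),
    f ∘ inj1 O_terminal X Y = g ∘ inj1 O_terminal X Y ->
    f ∘ inj2 O_terminal X Y = g ∘ inj2 O_terminal X Y -> f = g;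
  I_diagonal : exists d : hom (II : D) (II ⊕ II),
    (inj1 O_terminal II II)† ∘ d <> hzero O_terminal II II /\
    (inj2 O_terminal II II)† ∘ d <> hzero O_terminal II II;
  I_simple : exactly_two_dagger_subobjects (II : D);
  I_separator : forall (X Y Z : D) (f g : hom (X ⊗ Y) Z),
    (forall (x : hom II X) (y : hom II Y), f ∘ (x ⊗ₘ y) = g ∘ (x ⊗ₘ y)) ->
    f = g;
  dagger_equalisers : forall (X Y : D) (f g : hom X Y),
    exists (E : D) (e : hom E X), dagger_mono e /\ equaliser e f g;
  dagger_mono_kernel : forall (A X : D) (m : hom A X), dagger_mono m ->
    exists (Y : D) (f : hom X Y), is_kernel O_terminal m f;
  epi_polar : forall (A X Y : D) (x : hom A X) (y : hom A Y), epic x -> epic y ->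
    (x† ∘ x = y† ∘ y <-> exists2 f : hom X Y, is_iso f & y = f ∘ x);
  bounded_colimits : forall (X : nat -> D) (f : forall n, hom (X n) (X n.+1)),
    bounded_seq f -> has_colimit f;
  all_dagger_finite : forall X : D, dagger_finite X }.

(* X = I (x) X -> I (x) Y = Y, the middle map being a (x) f *)
Definition smul (D : dagger_rig) (X Y : D) (a : hom (II : D) II) (f : hom X Y) :
    hom X Y :=
  mlunit otimes Y ∘ (a ⊗ₘ f) ∘ (mlunit otimes X)†.

Section DaggerTheory.
Variable C : dagger_category.
Implicit Types X Y Z : C.

Lemma dag_inj X Y (f g : hom X Y) : f† = g† -> f = g.
Proof. by move=> /(congr1 dag); rewrite !dagK. Qed.

Lemma dagger_iso_dag X Y (f : hom X Y) : dagger_iso f -> dagger_iso (f†).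
Proof. by move=> [h1 h2]; split; rewrite dagK. Qed.

Lemma dagger_isoI X Y Z (u : hom X Y) (f g : hom Y Z) :
  dagger_iso u -> f ∘ u = g ∘ u -> f = g.
Proof.
by move=> [_ h] /(congr1 (hcomp^~ (u†))); rewrite /= -!hcompA h !hcompf1.
Qed.

Lemma dagger_isoIl X Y Z (u : hom Y Z) (f g : hom X Y) :
  dagger_iso u -> u ∘ f = u ∘ g -> f = g.
Proof.
by move=> [h _] /(congr1 (hcomp (u†))); rewrite !hcompA h !hcomp1f.
Qed.

Variable M : dagger_smc C.
Local Notation "A · B" := (mob M A B) (at level 38, left associativity).
Local Notation "f ·ₘ g" := (mmor M f g) (at level 38, left associativity).
Local Notation J := (munit M).

Lemma mmor_iso X X' Y Y' (f : hom X X') (g : hom Y Y') :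
  dagger_iso f -> dagger_iso g -> dagger_iso (f ·ₘ g).
Proof.
by move=> [f1 f2] [g1 g2]; split; rewrite mmor_dag -mmorM ?f1 ?f2 ?g1 ?g2 mmor1.
Qed.

Lemma hid_iso X : dagger_iso \1_X.
Proof. by split; rewrite dag1 hcomp1f. Qed.

Lemma mmor_unit_injl X Y (f g : hom X Y) : \1_J ·ₘ f = \1_J ·ₘ g -> f = g.
Proof.
move=> e; apply: (dagger_isoI (mlunit_iso M X)).
by rewrite -!mlunit_nat e.
Qed.

Lemma mmor_unit_injr X Y (f g : hom X Y) : f ·ₘ \1_J = g ·ₘ \1_J -> f = g.
Proof.
move=> e; apply: (dagger_isoI (mrunit_iso M X)).
by rewrite -!mrunit_nat e.
Qed.

Lemma mmorMl A X Y Z (g : hom Y Z) (f : hom X Y) :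
  \1_A ·ₘ (g ∘ f) = (\1_A ·ₘ g) ∘ (\1_A ·ₘ f).
Proof. by rewrite -mmorM hcomp1f. Qed.

Lemma mmorMr A X Y Z (g : hom Y Z) (f : hom X Y) :
  (g ∘ f) ·ₘ \1_A = (g ·ₘ \1_A) ∘ (f ·ₘ \1_A).
Proof. by rewrite -mmorM hcomp1f. Qed.

Lemma mlunit_assoc A B :
  mlunit M (A · B) ∘ massoc M J A B = mlunit M A ·ₘ \1_B.
Proof.
apply: mmor_unit_injl; rewrite mmorMl.
apply: (dagger_isoI (massoc_iso M J (J · A) B)).
apply: (dagger_isoI (mmor_iso (massoc_iso M J J A) (hid_iso B))).
rewrite -!hcompA [X in _ ∘ X]hcompA -mpentagon hcompA mtriangle.
rewrite -(mmor1 M A B) -massoc_nat -mtriangle mmorMr hcompA massoc_nat.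
by rewrite hcompA.
Qed.

Lemma mlunit_sym A : mlunit M A ∘ msym M A J = mrunit M A.
Proof.
apply: mmor_unit_injr; rewrite mmorMr.
apply: (dagger_isoIl (msym_iso M A J)).
have := congr1 (hcomp (mlunit M (J · A))) (mhexagon M A J J).
rewrite !hcompA mlunit_assoc mlunit_nat -msym_nat -!hcompA mtriangle => ->.
by rewrite -mlunit_assoc -!hcompA.
Qed.

End DaggerTheory.

Section ScalarTheory.
Variables (D : dagger_rig) (ax : rig_axioms D).
Implicit Types X Y Z : D.
Local Notation hO := (O_terminal ax).
Local Notation scalar := (hom (II : D) II).
Local Notation "0" := (hzero hO _ _) : cat_scope.
Local Notation "a ⋆ f" := (smul a f) (at level 37, right associativity).
Local Notation p1 := (prj1 hO _ _).
Local Notation p2 := (prj2 hO _ _).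

Lemma bang_uniq X (f g : hom X OO) : f = g.
Proof. by case: (hO X) => h hP; rewrite (hP f) (hP g). Qed.

Lemma comp0f X Y Z (f : hom X Y) : hzero hO Y Z ∘ f = 0.
Proof. by rewrite /hzero -hcompA; congr hcomp; exact: bang_uniq. Qed.

Lemma dag0 X Y : (hzero hO X Y)† = 0.
Proof. by rewrite /hzero dagM dagK. Qed.

Lemma compf0 X Y Z (g : hom Y Z) : g ∘ hzero hO X Y = 0.
Proof. by apply: dag_inj; rewrite dagM !dag0 comp0f. Qed.

Lemma zero_to_O X (f : hom X OO) : f = 0. Proof. exact: bang_uniq. Qed.

Lemma id_neq0 : \1_II <> hzero hO II II.
Proof.
case: (I_diagonal ax) => d [h _] e; apply: h.
by rewrite -[LHS]hcomp1f e comp0f.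
Qed.

Lemma scalar_epi (a : scalar) : a <> 0 -> epic a.
Proof.
move=> a0 Z f g fg.
case: (dagger_equalisers ax f g) => E [e [edm [ee /(_ _ a fg)[u [au _]]]]].
case: (I_simple ax) => A1 [A2 [m1 [m2 [_ _ m12 m3]]]].
have mono_of A X (m : hom A X) : dagger_mono m -> monic m.
  by move=> h W p q /(congr1 (hcomp (m†))); rewrite !hcompA h !hcomp1f.
have iso1 X : is_iso \1_X by exists \1_X; rewrite hcomp1f.
have rep_of A X (m : hom A X) : dagger_mono m -> has_dagger_mono_rep m.
  by move=> h; exists A, m; split=> //; exists \1_A => //; rewrite hcompf1.
have symm A B X (m : hom A X) (n : hom B X) :
    same_subobject m n -> same_subobject n m.
  move=> [v [w [h1 h2]] ->]; exists w; first by exists v.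
  by rewrite -hcompA h2 hcompf1.
have trans A B B' X (m : hom A X) (n : hom B X) (k : hom B' X) :
    same_subobject m n -> same_subobject n k -> same_subobject m k.
  move=> [v [v' [h1 h2]] ->] [w [w' [h3 h4]] ->]; exists (w ∘ v); last first.
    by rewrite hcompA.
  exists (v' ∘ w'); rewrite -hcompA [X in _ ∘ X = _ /\ _]hcompA h3 hcomp1f.
  by rewrite h1 -hcompA [X in _ /\ _ ∘ X = _]hcompA h2 hcomp1f.
have zdm : dagger_mono (hzero hO OO II) by exact: bang_uniq.
have idm1 : dagger_mono \1_(II : D) by rewrite /dagger_mono dag1 hcomp1f.
have nz : ~ same_subobject e (hzero hO OO II).
  by move=> [v _ ev]; apply: a0; rewrite -au ev !comp0f.
have nz1 : ~ same_subobject \1_(II : D) (hzero hO OO II).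
  by move=> [v _ ev]; apply: id_neq0; rewrite ev comp0f.
have [|[v [v' [h1 h2]] ev]] : same_subobject e (hzero hO OO II) \/
    same_subobject e \1_(II : D); first 1 last.
- by [].
- rewrite hcomp1f in ev; subst e.
  by rewrite -[f]hcompf1 -[g]hcompf1 -h2 !hcompA ee.
have [k1|k1] := m3 _ _ (mono_of _ _ _ edm) (rep_of _ _ _ edm);
have [k2|k2] := m3 _ _ (mono_of _ _ _ zdm) (rep_of _ _ _ zdm);
have [k3|k3] := m3 _ _ (mono_of _ _ _ idm1) (rep_of _ _ _ idm1).
all: try by [left; apply: trans k1 (symm _ _ _ _ _ k2)].
all: try by [right; apply: trans k1 (symm _ _ _ _ _ k3)].
all: by case: nz1; apply: trans k3 (symm _ _ _ _ _ k2).
Qed.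

Lemma scalar_neq0M (b a : scalar) : b <> 0 -> a <> 0 -> b ∘ a <> 0.
Proof.
by move=> b0 a0 e; apply: b0; apply: (scalar_epi a0); rewrite e comp0f.
Qed.

Lemma scalar_neq0_dag (a : scalar) : a <> 0 -> a† <> 0.
Proof. by move=> a0 /(congr1 dag); rewrite dagK dag0. Qed.

Lemma smul1 X Y (f : hom X Y) : \1_II ⋆ f = f.
Proof.
by rewrite /smul mlunit_nat -hcompA (proj2 (mlunit_iso _ _)) hcompf1.
Qed.

Lemma smul_compr X Y Z (a : scalar) (g : hom Y Z) (f : hom X Y) :
  a ⋆ (g ∘ f) = g ∘ (a ⋆ f).
Proof.
rewrite /smul -[a in LHS]hcomp1f mmorM !hcompA; congr (_ ∘ _ ∘ _).
by rewrite mlunit_nat.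
Qed.

Lemma smul_compl X Y Z (a : scalar) (g : hom Y Z) (f : hom X Y) :
  a ⋆ (g ∘ f) = (a ⋆ g) ∘ f.
Proof.
rewrite /smul -[a in LHS]hcompf1 mmorM -!hcompA; congr (_ ∘ (_ ∘ _)).
apply: dag_inj; rewrite !dagM !dagK mmor_dag dag1.
exact: mlunit_nat.
Qed.

Lemma smulE X Y (a : scalar) (f : hom X Y) : a ⋆ f = f ∘ (a ⋆ \1_X).
Proof. by rewrite -smul_compr hcompf1. Qed.

Lemma smulM X Y (b a : scalar) (f : hom X Y) : (b ∘ a) ⋆ f = b ⋆ (a ⋆ f).
Proof.
rewrite smulE [a ⋆ f]smulE smul_compr; congr hcomp.
rewrite -[a ⋆ \1_X]hcomp1f smul_compl /smul -{1}(hcomp1f \1_X) mmorM -!hcompA.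
congr (_ ∘ (_ ∘ _)).
by rewrite [RHS]hcompA (proj1 (mlunit_iso _ _)) hcomp1f.
Qed.

Lemma smulCA X Y (b a : scalar) (f : hom X Y) : b ⋆ (a ⋆ f) = a ⋆ (b ⋆ f).
Proof. by rewrite [a ⋆ f]smulE smul_compl -smulE. Qed.

Lemma smul_dag X Y (a : scalar) (f : hom X Y) : (a ⋆ f)† = a† ⋆ f†.
Proof. by rewrite /smul !dagM mmor_dag dagK hcompA. Qed.

Lemma smul_id_neq0 (a : scalar) : a <> 0 -> a ⋆ \1_II <> 0.
Proof.
move=> a0 e; apply: a0.
have ae : a ⊗ₘ \1_II = (mlunit otimes II)† ∘ (a ⋆ \1_II) ∘ mlunit otimes II.
  rewrite /smul -!hcompA (proj1 (mlunit_iso _ _)) hcompf1.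
  by rewrite hcompA (proj1 (mlunit_iso _ _)) hcomp1f.
apply: (dagger_isoI (mrunit_iso otimes II)).
by rewrite -mrunit_nat ae e compf0 !comp0f compf0.
Qed.

Lemma smul_inj X Y (a : scalar) (f g : hom X Y) :
  a <> 0 -> a ⋆ f = a ⋆ g -> f = g.
Proof.
move=> a0 e; apply: (dagger_isoI (mrunit_iso otimes X)).
apply: (I_separator ax) => x y.
have xy (h : hom X Y) :
    h ∘ mrunit otimes X ∘ (x ⊗ₘ y) = h ∘ x ∘ (mrunit otimes II ∘ (\1_II ⊗ₘ y)).
  rewrite -[x in x ⊗ₘ y]hcompf1 -[y in _ ⊗ₘ y]hcomp1f mmorM !hcompA.
  by congr (_ ∘ _); rewrite -!hcompA mrunit_nat.
rewrite !xy; congr (_ ∘ _); apply: (scalar_epi (smul_id_neq0 a0)).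
by rewrite -!smulE !smul_compl e.
Qed.

Lemma prj1E X Y : prj1 hO X Y = mrunit oplus X ∘ (\1_X ⊕ₘ 0).
Proof. by rewrite /prj1 /inj1 dagM dagK mmor_dag dag1 dag0. Qed.

Lemma prj2E X Y : prj2 hO X Y = mlunit oplus Y ∘ (0 ⊕ₘ \1_Y).
Proof. by rewrite /prj2 /inj2 dagM dagK mmor_dag dag1 dag0. Qed.

Lemma prj2_sym X Y : prj2 hO Y X ∘ msym oplus X Y = prj1 hO X Y.
Proof.
by rewrite prj1E prj2E -mlunit_sym -!hcompA msym_nat.
Qed.

Lemma prj1_nat X X' Y Y' (f : hom X X') (g : hom Y Y') :
  prj1 hO X' Y' ∘ (f ⊕ₘ g) = f ∘ prj1 hO X Y.
Proof.
rewrite !prj1E -hcompA -mmorM hcomp1f comp0f hcompA -mrunit_nat -hcompA -mmorM.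
by rewrite hcompf1 hcomp1f.
Qed.

Lemma prj2_nat X X' Y Y' (f : hom X X') (g : hom Y Y') :
  prj2 hO X' Y' ∘ (f ⊕ₘ g) = g ∘ prj2 hO X Y.
Proof.
rewrite !prj2E -hcompA -mmorM hcomp1f comp0f hcompA -mlunit_nat -hcompA -mmorM.
by rewrite hcompf1 hcomp1f.
Qed.

Lemma prj2_distl A X Y :
  prj2 hO (A ⊗ X) (A ⊗ Y) ∘ distl A X Y = \1_A ⊗ₘ prj2 hO X Y.
Proof.
rewrite [in RHS]prj2E mmorMl -(distl_annr (rigP D)) -hcompA.
rewrite (distl_nat (rigP D)) hcompA prj2E; congr (_ ∘ _).
rewrite -hcompA -mmorM mmor1 hcomp1f; congr (_ ∘ mmor oplus _ _).
exact: bang_uniq.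
Qed.

Lemma prj1_distl A X Y :
  prj1 hO (A ⊗ X) (A ⊗ Y) ∘ distl A X Y = \1_A ⊗ₘ prj1 hO X Y.
Proof.
rewrite -prj2_sym -hcompA (distl_sym (rigP D)) hcompA prj2_distl -mmorMl.
by rewrite prj2_sym.
Qed.

Lemma prj1_distr X Y A :
  prj1 hO (X ⊗ A) (Y ⊗ A) ∘ distr X Y A = prj1 hO X Y ⊗ₘ \1_A.
Proof.
apply: (dagger_isoIl (msym_iso otimes X A)).
rewrite hcompA -(prj1_nat _ (msym otimes Y A)) -hcompA (distr_sym (rigP D)).
by rewrite hcompA prj1_distl msym_nat.
Qed.

Lemma prj2_distr X Y A :
  prj2 hO (X ⊗ A) (Y ⊗ A) ∘ distr X Y A = prj2 hO X Y ⊗ₘ \1_A.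
Proof.
apply: (dagger_isoIl (msym_iso otimes Y A)).
rewrite hcompA -(prj2_nat (msym otimes X A)) -hcompA (distr_sym (rigP D)).
by rewrite hcompA prj2_distl msym_nat.
Qed.

Lemma prj_jointly_monic X Y Z (f g : hom Z (X ⊕ Y)) :
  prj1 hO X Y ∘ f = prj1 hO X Y ∘ g -> prj2 hO X Y ∘ f = prj2 hO X Y ∘ g -> f = g.
Proof.
move=> e1 e2; apply: dag_inj; apply: (inj_jointly_epic (r := ax)); apply: dag_inj.
  by rewrite dagM dagK [RHS]dagM dagK.
by rewrite dagM dagK [RHS]dagM dagK.
Qed.

Lemma weak_diagonal : exists d1 d2 : scalar, [/\ d1 <> 0, d2 <> 0 &
  forall Z, exists d : hom Z (Z ⊕ Z),
    p1 ∘ d = d1 ⋆ \1_Z /\ p2 ∘ d = d2 ⋆ \1_Z].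
Proof.
case: (I_diagonal ax) => d [d1 d2].
exists (p1 ∘ d), (p2 ∘ d); split=> // Z.
exists ((mlunit otimes Z ⊕ₘ mlunit otimes Z) ∘ distr II II Z ∘ (d ⊗ₘ \1_Z) ∘
  (mlunit otimes Z)†); rewrite !hcompA prj1_nat prj2_nat.
rewrite -![_ ∘ _ ∘ distr _ _ _]hcompA prj1_distr prj2_distr.
by rewrite -![_ ∘ _ ∘ (d ⊗ₘ _)]hcompA -!mmorM hcomp1f.
Qed.

End ScalarTheory.

Record frac (D : dagger_rig) (ax : rig_axioms D) (X Y : D) := Frac {
  num : hom X Y;
  den : hom (II : D) II;
  den_neq0 : den <> hzero (O_terminal ax) II II }.

Arguments den_neq0 {D ax X Y} p _ : rename.

HB.instance Definition _ D ax X Y := gen_eqMixin (@frac D ax X Y).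
HB.instance Definition _ D ax X Y := gen_choiceMixin (@frac D ax X Y).

Section Localisation.
Variables (D : dagger_rig) (ax : rig_axioms D).
Implicit Types X Y Z W : D.
Local Notation hO := (O_terminal ax).
Local Notation "a ⋆ f" := (smul a f) (at level 37, right associativity).

Definition frac_eqv X Y (p q : frac ax X Y) : bool :=
  `[< den q ⋆ num p = den p ⋆ num q >].

Lemma frac_eqv_refl X Y : reflexive (@frac_eqv X Y).
Proof. by move=> p; apply/asboolP. Qed.

Lemma frac_eqv_sym X Y : symmetric (@frac_eqv X Y).
Proof. by move=> p q; apply/asboolP/asboolP. Qed.

Lemma frac_eqv_trans X Y : transitive (@frac_eqv X Y).
Proof.
move=> q p r /asboolP pq /asboolP qr; apply/asboolP.
apply: (smul_inj (den_neq0 q)).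
by rewrite smulCA pq smulCA qr smulCA.
Qed.

Canonical frac_equiv X Y :=
  EquivRel (@frac_eqv X Y) (@frac_eqv_refl X Y) (@frac_eqv_sym X Y)
    (@frac_eqv_trans X Y).

Definition loc_hom X Y := {eq_quot (frac_equiv X Y)}.

Lemma loc_eqP X Y (p q : frac ax X Y) :
  \pi_(loc_hom X Y) p = \pi_(loc_hom X Y) q <->
  den q ⋆ num p = den p ⋆ num q.
Proof.
split=> [/eqmodP /asboolP //|e]; apply/eqmodP; exact/asboolP.
Qed.

Definition loc_map X Y (f : hom X Y) : loc_hom X Y :=
  \pi_(loc_hom X Y) (Frac f (@id_neq0 D ax)).

Definition frac_comp X Y Z (q : frac ax Y Z) (p : frac ax X Y) : frac ax X Z :=
  Frac (num q ∘ num p) (scalar_neq0M (den_neq0 q) (den_neq0 p)).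

Definition frac_dag X Y (p : frac ax X Y) : frac ax Y X :=
  Frac ((num p)†) (scalar_neq0_dag (den_neq0 p)).

Definition loc_comp X Y Z (g : loc_hom Y Z) (f : loc_hom X Y) : loc_hom X Z :=
  \pi_(loc_hom X Z) (frac_comp (repr g) (repr f)).

Definition loc_dag X Y (f : loc_hom X Y) : loc_hom Y X :=
  \pi_(loc_hom Y X) (frac_dag (repr f)).

Lemma loc_compE X Y Z (q : frac ax Y Z) (p : frac ax X Y) :
  loc_comp (\pi q) (\pi p) = \pi_(loc_hom X Z) (frac_comp q p).
Proof.
have /loc_eqP e1 := reprK (\pi_(loc_hom Y Z) q).
have /loc_eqP e2 := reprK (\pi_(loc_hom X Y) p).
apply/loc_eqP; rewrite /= !smulM ![den p ⋆ _]smul_compr e2.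
by rewrite smul_compl e1 [in RHS]smul_compr -smul_compl.
Qed.

Lemma loc_dagE X Y (p : frac ax X Y) :
  loc_dag (\pi p) = \pi_(loc_hom Y X) (frac_dag p).
Proof.
have /loc_eqP e := reprK (\pi_(loc_hom X Y) p).
by apply/loc_eqP; rewrite /= -!smul_dag e.
Qed.

Lemma loc_compA X Y Z W (h : loc_hom Z W) (g : loc_hom Y Z) (f : loc_hom X Y) :
  loc_comp h (loc_comp g f) = loc_comp (loc_comp h g) f.
Proof.
elim/quotW: h => h; elim/quotW: g => g; elim/quotW: f => f.
by rewrite !loc_compE; apply/loc_eqP; rewrite /= !hcompA.
Qed.

Lemma loc_comp1f X Y (f : loc_hom X Y) : loc_comp (loc_map \1_Y) f = f.
Proof.
by elim/quotW: f => f; rewrite !loc_compE; apply/loc_eqP; rewrite /= !hcomp1f.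
Qed.

Lemma loc_compf1 X Y (f : loc_hom X Y) : loc_comp f (loc_map \1_X) = f.
Proof.
by elim/quotW: f => f; rewrite !loc_compE; apply/loc_eqP; rewrite /= !hcompf1.
Qed.

Lemma loc_dag1 X : loc_dag (loc_map \1_X) = loc_map \1_X.
Proof. by rewrite loc_dagE; apply/loc_eqP; rewrite /= !dag1. Qed.

Lemma loc_dagM X Y Z (g : loc_hom Y Z) (f : loc_hom X Y) :
  loc_dag (loc_comp g f) = loc_comp (loc_dag f) (loc_dag g).
Proof.
elim/quotW: g => g; elim/quotW: f => f.
by rewrite loc_compE !loc_dagE loc_compE; apply/loc_eqP; rewrite /= !dagM.
Qed.

Lemma loc_dagK X Y (f : loc_hom X Y) : loc_dag (loc_dag f) = f.
Proof. by elim/quotW: f => f; rewrite !loc_dagE; apply/loc_eqP; rewrite /= !dagK. Qed.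

Definition localisation : dagger_category :=
  DaggerCategory (dcat := Category loc_compA loc_comp1f loc_compf1)
    loc_dag1 loc_dagM loc_dagK.

Local Notation C := localisation.

Definition loc_prj1 X Y : hom (X ⊕ Y : C) (X : C) := loc_map (prj1 hO X Y).

Definition loc_prj2 X Y : hom (X ⊕ Y : C) (Y : C) := loc_map (prj2 hO X Y).

Lemma loc_product (X Y : D) (Z : C) (f : hom Z (X : C)) (g : hom Z (Y : C)) :
  exists h : hom Z (X ⊕ Y : C),
    (loc_prj1 X Y ∘ h = f /\ loc_prj2 X Y ∘ h = g) /\
    forall h' : hom Z (X ⊕ Y : C),
      loc_prj1 X Y ∘ h' = f -> loc_prj2 X Y ∘ h' = g -> h' = h.
Proof.
suff [h [h1 h2]] : exists h : hom Z (X ⊕ Y : C),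
    loc_prj1 X Y ∘ h = f /\ loc_prj2 X Y ∘ h = g.
  exists h; split=> // h'; rewrite -h1 -h2.
  elim/quotW: h {h1 h2} => h; elim/quotW: h' => h'.
  rewrite /hcomp /= /loc_prj1 /loc_prj2 /loc_map. 
  rewrite !loc_compE.
  move=> /loc_eqP /= + /loc_eqP /=; rewrite !hcomp1f => e1 e2.
  apply/loc_eqP; apply: (prj_jointly_monic (ax := ax)).
    by rewrite -!smul_compr.
  by rewrite -!smul_compr.
elim/quotW: f => -[f a a0]; elim/quotW: g => -[g b b0].
have [d1 [d2 [d10 d20 /(_ Z)[d [e1 e2]]]]] := weak_diagonal ax.
exists (\pi_(loc_hom Z (X ⊕ Y)) (Frac
  ((((b ∘ d2) ⋆ f) ⊕ₘ ((a ∘ d1) ⋆ g)) ∘ d)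
  (scalar_neq0M (scalar_neq0M a0 d10) (scalar_neq0M b0 d20)))).
rewrite /hcomp /= /loc_prj1 /loc_prj2 /loc_map !loc_compE.
split; apply/loc_eqP; rewrite /= hcomp1f hcompA.
  rewrite prj1_nat -hcompA e1 -smul_compl -smulE !smulM.
  by rewrite [in RHS](smulCA d1 b) [in RHS](smulCA d1 d2).
rewrite prj2_nat -hcompA e2 -smul_compl -smulE !smulM.
by rewrite [in LHS](smulCA b a) [in LHS](smulCA b d1).
Qed.

Definition loc_pair (X Y : D) (Z : C) (f : hom Z (X : C)) (g : hom Z (Y : C)) :
    hom Z (X ⊕ Y : C) :=
  projT1 (cid (loc_product f g)).

(* The diagonal <1, 1> and its dagger, the codiagonal, are those of the dagger
   biproduct, and <f, g> = (f (+) g) <1, 1>. *)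
Definition loc_add (X Y : C) (f g : hom X Y) : hom X Y :=
  (loc_pair \1_Y \1_Y)† ∘ loc_pair f g.

Definition scalars := hom (II : C) (II : C).

Definition positive_scalars : set scalars :=
  [set c | exists (X : C) (x : hom (II : C) X), c = x† ∘ x]%classic.

(* On [scalars], the operations are [loc_add], composition and the dagger; a
   bijection preserving them and 1 also preserves 0, opposites and inverses. *)
Record involutive_field_iso (K : fieldType) (inv : K -> K) (phi : scalars -> K)
    : Prop := InvolutiveFieldIso {
  iso_bij : bijective phi;
  iso_add : forall x y : scalars, phi (loc_add x y) = (phi x + phi y)%R;
  iso_mul : forall x y : scalars, phi (x ∘ y) = (phi x * phi y)%R;
  iso_one : phi \1_(II : C) = 1%R;
  iso_inv : forall x : scalars, phi (x†) = inv (phi x) }.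

End Localisation.

Arguments scalars {D} ax.
Arguments positive_scalars {D} ax.
Arguments involutive_field_iso {D ax} K inv phi.

(* Main.v *)
From HB Require Import structures.
From mathcomp Require Import all_boot all_order all_algebra.
From mathcomp Require Import ring lra.
From mathcomp Require Import boolp classical_sets reals complex.
Require Import Defs.

Set Implicit Arguments.
Unset Strict Implicit.
Unset Printing Implicit Defensive.

(** Write I for the tensor unit, D for the category of contractions and C for
    its localisation. The scalars of C form a field with an involution, ordered
    by the cone P of the values x†x of vectors x : I -> X. Everything rests on
    comparing that algebraic order with a second, categorical one: say that a
    is dominated by b when a = x†x, b = y†y and x = f y for some f that comes
    from D, that is, when x is the image of y under a contraction.

    The polar axiom on epimorphisms, together with the image factorisation
    that dagger equalisers provide, shows that a vector is determined by its
    value x†x up to a partial isometry of D ([gram_cofactor]), so domination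
    does not depend on the chosen vectors and is a preorder. It is
    antisymmetric because mutually inverse contractions preserve x†x, and it
    is compatible with sums and products because contractions may be added
    with ⊕ and tensored. It contains the algebraic order, since the
    projections of X ⊕ Y lie in D: x†x is dominated by x†x + z†z. Finally
    ([dominated_inf]), a sequence that decreases for domination amounts to a
    sequential diagram of one-dimensional objects under the unit; a nonzero
    lower bound is a cocone of monomorphisms over it, and the colimit computes
    the infimum.

    From here on only the field is used ([star_field]). Infima of decreasing
    sequences commute with sums and products ([infimumD]), so the Newton
    iteration for the square root of c in P converges in P ([pos_sqrt]). Hence
    a self-adjoint a equals plus or minus the square root of the square a†a,
    and P orders the self-adjoint elements totally ([pos_total]). Totality
    forces domination to coincide with this order ([prec_subE]), so the
    self-adjoint elements form an ordered field in which decreasing sequences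
    with a positive lower bound have infima; such a field is Archimedean and
    Dedekind cuts identify it with the reals ([cut_sup]). If the involution is
    trivial this is the whole field. Otherwise some nonzero b satisfies
    b† = -b, and dividing b by the square root of b†b gives a square root of
    -1 which, with the self-adjoint elements, generates the field, as in the
    complex numbers. *)

Local Open Scope quotient_scope.
Local Open Scope cat_scope.

(** * Dagger kernels, images and scalars of contractions *)

(** Kelly's argument: tensored with the unit, both unitors equal the composite
    of the associator with the left unitor of [J ⊗ J]. *)
Lemma mlunit_munit (C : dagger_category) (M : dagger_smc C) :
  mlunit M (munit M) = mrunit M (munit M).
Proof.
apply: (mmor_unit_injr (M := M)); rewrite -mtriangle -mlunit_assoc.
congr (_ ∘ _); apply: (dagger_isoIl (mlunit_iso M (munit M))).
by rewrite mlunit_nat.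
Qed.

Section Contractions.
Variables (D : dagger_rig) (ax : rig_axioms D).
Implicit Types X Y Z : D.
Local Notation hO := (O_terminal ax).
Local Notation scalar := (hom (II : D) II).
Local Notation "0" := (hzero hO _ _) : cat_scope.
Local Notation "a ⋆ f" := (smul a f) (at level 37, right associativity).

Lemma smul_scalar X (a : scalar) (f : hom II X) : a ⋆ f = f ∘ a.
Proof.
rewrite smulE; congr (_ ∘ _).
by rewrite /smul mlunit_munit mrunit_nat -hcompA (proj2 (mrunit_iso _ _)) hcompf1.
Qed.

Lemma scalarC (a b : scalar) : a ∘ b = b ∘ a.
Proof. by rewrite -!smul_scalar -[b]hcomp1f -smul_scalar smulCA !smul_scalar !hcomp1f. Qed.

Lemma scalar_monic (a : scalar) : a <> 0 -> monic a.
Proof.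
move=> a0 Z f g e; apply: dag_inj.
by apply: (scalar_epi (scalar_neq0_dag a0)); rewrite -!dagM e.
Qed.

(** The separation axiom on [X ⊗ Y] at [Y = I]: there the second vector is a
    scalar, and composing with it preserves the assumed equality. *)
Lemma I_separates X Y (f g : hom X Y) :
  (forall x : hom II X, f ∘ x = g ∘ x) -> f = g.
Proof.
move=> e; apply: (dagger_isoI (mrunit_iso otimes X)).
apply: (I_separator ax) => x y.
have xy (h : hom X Y) :
    h ∘ mrunit otimes X ∘ (x ⊗ₘ y) = h ∘ x ∘ (mrunit otimes II ∘ (\1_II ⊗ₘ y)).
  rewrite -[x in x ⊗ₘ y]hcompf1 -[y in _ ⊗ₘ y]hcomp1f mmorM !hcompA.
  by congr (_ ∘ _); rewrite -!hcompA mrunit_nat.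
by rewrite !xy e.
Qed.

Lemma dagger_mono_monic X Y (m : hom X Y) : dagger_mono m -> monic m.
Proof. by move=> h W p q /(congr1 (hcomp (m†))); rewrite !hcompA h !hcomp1f. Qed.

Lemma dagger_kernel X Y (f : hom X Y) :
  exists (K : D) (k : hom K X), dagger_mono k /\ is_kernel hO k f.
Proof. exact: dagger_equalisers. Qed.

(** Coequalise a pair [g, h] with [f g = f h] by a dagger epimorphism: it is the
    adjoint of a kernel of some [r], so [f] kills [r†]; hence [r] is zero, its
    kernel is invertible, and [g = h]. *)
Lemma ker0_monic X Y (f : hom X Y) :
  (forall Z (g : hom Z X), f ∘ g = 0 -> g = 0) -> monic f.
Proof.
move=> f0 Z g h fgh.
have [E [e [em [ge he]]]] := dagger_equalisers ax (g†) (h†).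
have [|u [eu _]] := he _ (f†); first by rewrite -!dagM fgh.
have [W [r [re hr]]] := dagger_mono_kernel ax em.
have r0 : r† = 0.
  apply: f0; rewrite -[f]dagK -eu dagM -hcompA -[e† ∘ r†]dagM re.
  by rewrite comp0f dag0 compf0.
have [|w [ew _]] := hr _ \1_X.
  by rewrite hcompf1 comp0f -[r]dagK r0 dag0.
by apply: dag_inj; rewrite -[g†]hcompf1 -[h†]hcompf1 -ew !hcompA ge.
Qed.

(** The image is the kernel [m] of the cokernel [k†] of [f]. A subobject [q] that
    equalises [g] and [h] and through which [f = m e] factors gives a dagger
    subobject [m q], again a kernel, that contains the image; so [q] splits. *)
Lemma image_factorisation X Y (f : hom X Y) :
  exists (M : D) (m : hom M Y) (e : hom X M),
    [/\ dagger_mono m, epic e & f = m ∘ e].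
Proof.
have [K [k [km [k0 hk]]]] := dagger_kernel (f†).
have [M [m [mm [m0 hm]]]] := dagger_kernel (k†).
rewrite comp0f in k0; rewrite comp0f in m0.
have [|e [me _]] := hm _ f.
  by apply: dag_inj; rewrite dagM dagK k0 comp0f dag0.
exists M, m, e; split=> // Z g h ghe.
(* [Q] equalises [g] and [h]; it must be all of [M]. *)
have [Q [q [qm [gq hq]]]] := dagger_equalisers ax g h.
have [e' [qe _]] := hq _ e ghe.
have mqm : dagger_mono (m ∘ q).
  by rewrite /dagger_mono dagM -hcompA [m† ∘ _]hcompA mm hcomp1f.
have [W [r [r0 hr]]] := dagger_mono_kernel ax mqm.
rewrite comp0f in r0.
have [|v [kv _]] := hk _ (r†).
  apply: dag_inj; rewrite dagM !dagK -me -qe !comp0f dag0 [m ∘ _]hcompA hcompA.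
  by rewrite r0 comp0f.
have [|w [mqw _]] := hr _ m.
  by rewrite comp0f -[r]dagK -kv dagM -hcompA m0 compf0.
have qw : q ∘ w = \1_M.
  by apply: (dagger_mono_monic mm); rewrite hcompA mqw hcompf1.
by rewrite -[g]hcompf1 -[h]hcompf1 -qw !hcompA gq.
Qed.

(** [x† x = 0] puts the image of [x] inside the kernel of [x†], which is
    orthogonal to it. *)
Lemma dag_comp_eq0 X Y (x : hom X Y) : x† ∘ x = 0 -> x = 0.
Proof.
move=> x0; have [K [k [km [k0 hk]]]] := dagger_kernel (x†).
have [|u [ku _]] := hk _ x; first by rewrite x0 comp0f.
rewrite -ku -[u]hcomp1f -km -[k† ∘ _ ∘ _]hcompA ku -[x in k† ∘ x]dagK.
by rewrite -dagM k0 comp0f dag0 compf0.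
Qed.

(** The epimorphic parts of [x] and [y] have the same [e† e], so the polar axiom
    relates them by an isomorphism; the partial isometry [h] carries the image
    of [y] onto that of [x]. *)
Lemma gram_factor A X Y (x : hom A X) (y : hom A Y) :
  x† ∘ x = y† ∘ y -> exists h : hom Y X, x = h ∘ y.
Proof.
have [M [m [e [mm ee ->]]]] := image_factorisation x.
have [N [n [e' [nn ee' ->]]]] := image_factorisation y.
rewrite !dagM -!hcompA [m† ∘ _]hcompA mm [n† ∘ (n ∘ _)]hcompA nn !hcomp1f.
move=> /esym h.
have [u _ eu] := (epi_polar ax ee' ee).1 h.
exists (m ∘ u ∘ n†); rewrite eu !hcompA; congr (_ ∘ _).
by rewrite -[RHS]hcompA nn hcompf1.
Qed.

Definition pointed_tensor Z X (z : hom II Z) (x : hom II X) : hom II (Z ⊗ X) :=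
  (z ⊗ₘ x) ∘ (mlunit otimes II)†.

Lemma gram_pointed_tensor Z X (z : hom II Z) (x : hom II X) :
  (pointed_tensor z x)† ∘ pointed_tensor z x = x† ∘ x ∘ (z† ∘ z).
Proof.
rewrite /pointed_tensor dagM dagK mmor_dag -!hcompA [_ ∘ (_ ∘ (mlunit _ _)†)]hcompA.
by rewrite -mmorM !hcompA -/(smul (z† ∘ z) (x† ∘ x)) smul_scalar !hcompA.
Qed.

Lemma pointed_tensor_map Z X Y (z : hom II Z) (x : hom II X) (f : hom X Y) :
  pointed_tensor z (f ∘ x) = (\1_Z ⊗ₘ f) ∘ pointed_tensor z x.
Proof. by rewrite /pointed_tensor hcompA -mmorM hcomp1f. Qed.

(** An epic vector spans a one-dimensional object. *)
Lemma epic_cogram X (e : hom II X) :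
  epic e -> e ∘ e† = (e† ∘ e) ⋆ \1_X.
Proof.
by move=> h; apply: h; rewrite -smul_compl hcomp1f smul_scalar hcompA.
Qed.

(** Contractions that are inverse to each other are unitary: this is the
    converse direction of the polar axiom. *)
Lemma mutual_factor_gram X Y (x : hom II X) (y : hom II Y)
    (f : hom Y X) (g : hom X Y) :
  epic x -> epic y -> x = f ∘ y -> y = g ∘ x -> x† ∘ x = y† ∘ y.
Proof.
move=> ex ey xf yg; apply: (epi_polar ax ex ey).2; exists g => //.
exists f; split; first by apply: ex; rewrite -hcompA -yg -xf hcomp1f.
by apply: ey; rewrite -hcompA -xf -yg hcomp1f.
Qed.

Lemma prj1_inj1 X Y : prj1 hO X Y ∘ inj1 hO X Y = \1_X.
Proof.
rewrite /inj1 hcompA prj1E -!hcompA [_ ∘ (_ ∘ (mrunit _ _)†)]hcompA -mmorM.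
rewrite hcomp1f (bang_uniq ax (hzero hO Y OO ∘ _) \1_OO) mmor1 hcomp1f.
exact: (mrunit_iso _ _).2.
Qed.

Lemma prj2_inj2 X Y : prj2 hO X Y ∘ inj2 hO X Y = \1_Y.
Proof.
rewrite /inj2 hcompA prj2E -!hcompA [_ ∘ (_ ∘ (mlunit _ _)†)]hcompA -mmorM.
rewrite hcomp1f (bang_uniq ax (hzero hO X OO ∘ _) \1_OO) mmor1 hcomp1f.
exact: (mlunit_iso _ _).2.
Qed.

Lemma prj2_inj1 X Y : prj2 hO X Y ∘ inj1 hO X Y = hzero hO X Y.
Proof. by rewrite /inj1 hcompA prj2_nat -hcompA comp0f. Qed.

Lemma prj1_inj2 X Y : prj1 hO X Y ∘ inj2 hO X Y = hzero hO Y X.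
Proof. by rewrite /inj2 hcompA prj1_nat -hcompA comp0f. Qed.

(** The source of additive inverses. If [d†] were monic it would identify the
    two distinct morphisms [i1 (p2 d)†] and [i2 (p1 d)†] of [I] into [I ⊕ I]; a
    nonzero [k] killed by [d†] is a pair of scalars, one a negative multiple of
    the other. *)
Lemma codiagonal_kernel : exists d k : hom II (II ⊕ II),
  [/\ prj1 hO II II ∘ d <> 0, prj2 hO II II ∘ d <> 0, k <> 0 & d† ∘ k = 0].
Proof.
have [d [d1 d2]] := I_diagonal ax; exists d.
have [[k [k0 dk]]|h] := pselect (exists k : hom II (II ⊕ II), k <> 0 /\ d† ∘ k = 0).
  by exists k.
have dm : monic (d†).
  apply: ker0_monic => Z g dg; apply: I_separates => z; rewrite comp0f.
  have [//|gz] := pselect (g ∘ z = 0); case: h; exists (g ∘ z); split=> //.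
  by rewrite hcompA dg comp0f.
have /dm/(congr1 (hcomp (prj1 hO II II))) :
    d† ∘ (inj1 hO II II ∘ (prj2 hO II II ∘ d)†) =
    d† ∘ (inj2 hO II II ∘ (prj1 hO II II ∘ d)†).
  have e1 : d† ∘ inj1 hO II II = (prj1 hO II II ∘ d)† by rewrite dagM dagK.
  have e2 : d† ∘ inj2 hO II II = (prj2 hO II II ∘ d)† by rewrite dagM dagK.
  by rewrite [LHS]hcompA [RHS]hcompA e1 e2 scalarC.
rewrite [LHS]hcompA [RHS]hcompA prj1_inj1 prj1_inj2 comp0f hcomp1f => /(congr1 dag).
by rewrite dagK dag0 => /d2.
Qed.

End Contractions.

(** * Addition in a category with dagger biproducts *)

(** Only the product half is recorded; taking adjoints gives the coproduct
    half. *)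
Record dagger_biproducts (C : dagger_category) := DaggerBiproducts {
  bizero : forall X Y : C, hom X Y;
  bisum : C -> C -> C;
  biproj1 : forall X Y, hom (bisum X Y) X;
  biproj2 : forall X Y, hom (bisum X Y) Y;
  bipair : forall X Y Z : C, hom Z X -> hom Z Y -> hom Z (bisum X Y);
  zerof : forall (X Y Z : C) (f : hom X Y), bizero Y Z ∘ f = bizero X Z;
  dag_zero : forall X Y : C, (bizero X Y)† = bizero Y X;
  p1_pair : forall (X Y Z : C) (f : hom Z X) (g : hom Z Y),
    biproj1 X Y ∘ bipair f g = f;
  p2_pair : forall (X Y Z : C) (f : hom Z X) (g : hom Z Y),
    biproj2 X Y ∘ bipair f g = g;
  p_monic : forall (X Y Z : C) (f g : hom Z (bisum X Y)),
    biproj1 X Y ∘ f = biproj1 X Y ∘ g -> biproj2 X Y ∘ f = biproj2 X Y ∘ g -> f = g;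
  p11 : forall X Y, biproj1 X Y ∘ (biproj1 X Y)† = \1_X;
  p22 : forall X Y, biproj2 X Y ∘ (biproj2 X Y)† = \1_Y;
  p21 : forall X Y, biproj2 X Y ∘ (biproj1 X Y)† = bizero X Y }.

Section DaggerBiproduct.
Variables (C : dagger_category) (B : dagger_biproducts C).
Local Notation zero := (bizero B).
Local Notation bi := (bisum B).
Local Notation p1 := (biproj1 B).
Local Notation p2 := (biproj2 B).
Local Notation pair := (bipair B).

Definition biadd X Y (f g : hom X Y) : hom X Y := (pair \1_Y \1_Y)† ∘ pair f g.
Local Notation "f + g" := (biadd f g) : cat_scope.

Lemma fzero (X Y Z : C) (g : hom Y Z) : g ∘ zero X Y = zero X Z.
Proof. by apply: dag_inj; rewrite dagM !dag_zero zerof. Qed.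

Lemma p12 X Y : p1 X Y ∘ (p2 X Y)† = zero Y X.
Proof. by rewrite -[p1 X Y]dagK -dagM p21 dag_zero. Qed.

Lemma inj_epic (X Y Z : C) (f g : hom (bi X Y) Z) :
  f ∘ (p1 X Y)† = g ∘ (p1 X Y)† -> f ∘ (p2 X Y)† = g ∘ (p2 X Y)† -> f = g.
Proof.
move=> e1 e2; apply: dag_inj; apply: p_monic; apply: dag_inj;
by rewrite !dagM !dagK.
Qed.

Lemma codiag1 X : (pair \1_X \1_X)† ∘ (p1 X X)† = \1_X.
Proof. by rewrite -dagM p1_pair dag1. Qed.

Lemma codiag2 X : (pair \1_X \1_X)† ∘ (p2 X X)† = \1_X.
Proof. by rewrite -dagM p2_pair dag1. Qed.

Lemma biadd_compr X Y Z (f g : hom Y Z) (h : hom X Y) :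
  (f + g) ∘ h = f ∘ h + g ∘ h.
Proof.
rewrite /biadd -hcompA; congr (_ ∘ _).
by apply: p_monic; rewrite hcompA ?p1_pair ?p2_pair.
Qed.

Lemma biaddf0 X Y (f : hom X Y) : f + zero X Y = f.
Proof.
rewrite /biadd (_ : pair _ _ = (p1 Y Y)† ∘ f) ?hcompA ?codiag1 ?hcomp1f //.
by apply: p_monic; rewrite hcompA ?p1_pair ?p2_pair ?p11 ?p21 ?hcomp1f ?zerof.
Qed.

Lemma biadd0f X Y (f : hom X Y) : zero X Y + f = f.
Proof.
rewrite /biadd (_ : pair _ _ = (p2 Y Y)† ∘ f) ?hcompA ?codiag2 ?hcomp1f //.
by apply: p_monic; rewrite hcompA ?p1_pair ?p2_pair ?p12 ?p22 ?hcomp1f ?zerof.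
Qed.

(** Laws of addition reduce to laws for the projections, which are then checked
    on the two injections. *)
Lemma biadd_proj X Y (f g : hom X Y) :
  f + g = (p1 Y Y + p2 Y Y) ∘ pair f g.
Proof. by rewrite biadd_compr p1_pair p2_pair. Qed.

Lemma biadd_compl X Y Z (h : hom Y Z) (f g : hom X Y) :
  h ∘ (f + g) = h ∘ f + h ∘ g.
Proof.
have -> : h ∘ f + h ∘ g = (h ∘ p1 Y Y + h ∘ p2 Y Y) ∘ pair f g.
  by rewrite biadd_compr -!hcompA p1_pair p2_pair.
rewrite [f + g]biadd_proj hcompA; congr (_ ∘ _); apply: inj_epic.
  by rewrite -hcompA !biadd_compr -!hcompA p11 p21 fzero !biaddf0 hcompf1.
by rewrite -hcompA !biadd_compr -!hcompA p12 p22 fzero !biadd0f hcompf1.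
Qed.

Lemma biaddC X Y (f g : hom X Y) : f + g = g + f.
Proof.
rewrite biadd_proj [g + f](_ : _ = (p2 Y Y + p1 Y Y) ∘ pair f g); last first.
  by rewrite biadd_compr p1_pair p2_pair.
congr (_ ∘ _); apply: inj_epic.
  by rewrite !biadd_compr p11 p21 biaddf0 biadd0f.
by rewrite !biadd_compr p12 p22 biaddf0 biadd0f.
Qed.

Lemma biaddA X Y (f g h : hom X Y) : f + (g + h) = (f + g) + h.
Proof.
pose w := pair f (pair g h).
pose q1 := p1 Y (bi Y Y); pose q := p2 Y (bi Y Y).
have e1 : q1 ∘ w = f by exact: p1_pair.
have e2 : p1 Y Y ∘ q ∘ w = g by rewrite -hcompA p2_pair p1_pair.
have e3 : p2 Y Y ∘ q ∘ w = h by rewrite -hcompA !p2_pair.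
rewrite -e1 -e2 -e3 -!biadd_compr; congr (_ ∘ _); apply: inj_epic.
  rewrite !biadd_compr -!hcompA p11 p21 !fzero.
  by rewrite !biaddf0.
rewrite !biadd_compr -!hcompA p12 p22 !hcompf1.
by rewrite !biadd0f.
Qed.

Lemma biadd_dag X Y (f g : hom X Y) : (f + g)† = f† + g†.
Proof.
have e Z W (u v : hom Z W) : pair u v = (p1 W W)† ∘ u + (p2 W W)† ∘ v.
  apply: p_monic; rewrite ?p1_pair ?p2_pair biadd_compl !hcompA ?p11 ?p12 ?p21.
    by rewrite hcomp1f zerof biaddf0.
  by rewrite p22 hcomp1f zerof biadd0f.
rewrite {1}/biadd dagM dagK (e _ _ \1_Y) biadd_compl !hcompf1 -!dagM.
by rewrite p1_pair p2_pair.
Qed.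

(** The inner product of two pairs is the sum of the inner products, since
    [i1 p1 + i2 p2] is the identity. *)
Lemma dag_pair_pair W X Y Z (f : hom Z X) (g : hom Z Y) (h : hom W X) (k : hom W Y) :
  (pair f g)† ∘ pair h k = f† ∘ h + g† ∘ k.
Proof.
have -> : f† ∘ h + g† ∘ k =
    (pair f g)† ∘ ((p1 X Y)† ∘ p1 X Y + (p2 X Y)† ∘ p2 X Y) ∘ pair h k.
  rewrite biadd_compl biadd_compr !hcompA -!dagM p1_pair p2_pair.
  by rewrite -!hcompA p1_pair p2_pair.
suff -> : (p1 X Y)† ∘ p1 X Y + (p2 X Y)† ∘ p2 X Y = \1_(bi X Y).
  by rewrite hcompf1.
apply: p_monic; rewrite biadd_compl !hcompA hcompf1.
  by rewrite p11 p12 zerof hcomp1f biaddf0.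
by rewrite p21 p22 zerof hcomp1f biadd0f.
Qed.

End DaggerBiproduct.

(** * The localisation as a category with dagger biproducts *)

Section Localisation.
Variables (D : dagger_rig) (ax : rig_axioms D).
Implicit Types X Y Z W : D.
Local Notation hO := (O_terminal ax).
Local Notation C := (localisation ax).
(** [loc_map] retyped with values in the homs of the category [C], so that
    composition and dagger elaborate there. *)
Definition loc_functor X Y (f : hom X Y) : hom (X : C) (Y : C) := loc_map ax f.
Local Notation U := loc_functor.
Local Notation scalar := (hom (II : D) II).
Local Notation I := (II : D).

Lemma loc_mapM X Y Z (g : hom Y Z) (f : hom X Y) :
  U (g ∘ f) = (U g : hom (Y : C) (Z : C)) ∘ U f.
Proof.
by rewrite /loc_functor /hcomp /= /loc_map loc_compE; apply/loc_eqP; rewrite /= hcomp1f.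
Qed.

Lemma loc_map_dag X Y (f : hom X Y) : U (f†) = (U f : hom (X : C) (Y : C))†.
Proof.
by rewrite /loc_functor /dag /= /loc_map loc_dagE; apply/loc_eqP; rewrite /= dag1.
Qed.

Lemma loc_map_inj X Y (f g : hom X Y) : U f = U g -> f = g.
Proof. by move/loc_eqP; rewrite /= !smul1. Qed.

(** A vector of the localisation is cleared of its denominator [s]; scalar
    equations are then proved among contractions. *)
Lemma loc_clear X (x : hom (I : C) (X : C)) :
  exists2 s : scalar, s <> hzero hO _ _ &
    exists x0 : hom I X, x ∘ U s = U x0.
Proof.
elim/quotW: x => -[f a a0]; exists a => //; exists f.
rewrite /loc_functor /hcomp /= /loc_map loc_compE; apply/loc_eqP => /=.
by rewrite smul1 hcompf1 smul_scalar.
Qed.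

Lemma loc_scalar_inv (s : scalar) : s <> hzero hO _ _ ->
  exists t : hom (I : C) (I : C), (U s : hom (I : C) (I : C)) ∘ t = \1_(I : C).
Proof.
move=> s0; exists (\pi_(loc_hom ax I I) (Frac \1_I s0)).
rewrite /loc_functor /hcomp /= /loc_map loc_compE; apply/loc_eqP => /=.
by rewrite hcompf1 hcomp1f smul1 smul_scalar hcomp1f.
Qed.

Lemma loc_scalarC (a b : scalars ax) : a ∘ b = b ∘ a.
Proof.
rewrite /scalars in a b *.
elim/quotW: a => -[a s s0]; elim/quotW: b => -[b t t0].
rewrite /hcomp /= !loc_compE; apply/loc_eqP => /=.
by rewrite [a ∘ b]scalarC [s ∘ t]scalarC.
Qed.

Lemma loc_scalar_epi (s : scalar) X (f g : hom (I : C) (X : C)) :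
  s <> hzero hO _ _ -> f ∘ U s = g ∘ U s -> f = g.
Proof.
move=> s0 e; have [t st] := loc_scalar_inv s0.
by rewrite -[f]hcompf1 -[g]hcompf1 -st !hcompA e.
Qed.

Local Notation zero X Y := (U (hzero hO X Y) : hom (X : C) (Y : C)).

Lemma loc0f (X Y Z : C) (f : hom X Y) : zero Y Z ∘ f = zero X Z.
Proof.
elim/quotW: f => f; rewrite /loc_functor /hcomp /= /loc_map loc_compE; apply/loc_eqP => /=.
by rewrite !comp0f smulE comp0f smulE comp0f.
Qed.

Lemma loc_dag0 (X Y : C) : (zero X Y)† = zero Y X.
Proof. by rewrite -loc_map_dag dag0. Qed.

Local Notation q1 X Y := (@loc_prj1 D ax X Y).
Local Notation q2 X Y := (@loc_prj2 D ax X Y).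

Lemma loc_prj11 (X Y : C) : q1 X Y ∘ (q1 X Y)† = \1_X.
Proof.
rewrite -?[loc_prj1 _ _ _]/(U _) -?[loc_prj2 _ _ _]/(U _).
by rewrite -loc_map_dag -loc_mapM dagK prj1_inj1. Qed.

Lemma loc_prj22 (X Y : C) : q2 X Y ∘ (q2 X Y)† = \1_Y.
Proof.
rewrite -?[loc_prj1 _ _ _]/(U _) -?[loc_prj2 _ _ _]/(U _).
by rewrite -loc_map_dag -loc_mapM dagK prj2_inj2. Qed.

Lemma loc_prj21 (X Y : C) : q2 X Y ∘ (q1 X Y)† = zero X Y.
Proof.
rewrite -?[loc_prj1 _ _ _]/(U _) -?[loc_prj2 _ _ _]/(U _).
by rewrite -loc_map_dag -loc_mapM dagK prj2_inj1. Qed.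

Lemma loc_prj1_pair (X Y Z : C) (f : hom Z X) (g : hom Z Y) :
  q1 X Y ∘ loc_pair f g = f.
Proof. by rewrite /loc_pair; case: (cid _) => h /= [[]]. Qed.

Lemma loc_prj2_pair (X Y Z : C) (f : hom Z X) (g : hom Z Y) :
  q2 X Y ∘ loc_pair f g = g.
Proof. by rewrite /loc_pair; case: (cid _) => h /= [[]]. Qed.

Lemma loc_prj_monic (X Y Z : C) (f g : hom Z (X ⊕ Y : C)) :
  q1 X Y ∘ f = q1 X Y ∘ g -> q2 X Y ∘ f = q2 X Y ∘ g -> f = g.
Proof.
move=> e1 e2; have [h [_ u]] := loc_product (q1 X Y ∘ f) (q2 X Y ∘ f).
by rewrite (u f) // (u g).
Qed.

Definition loc_biproducts : dagger_biproducts C :=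
  DaggerBiproducts loc0f loc_dag0 loc_prj1_pair loc_prj2_pair
    loc_prj_monic loc_prj11 loc_prj22 loc_prj21.

End Localisation.

(** * The field of scalars *)

Section ScalarRing.
Variables (D : dagger_rig) (ax : rig_axioms D).
Local Notation hO := (O_terminal ax).
Local Notation C := (localisation ax).
Local Notation U := (@loc_functor D ax _ _).
Local Notation I := (II : C).
Local Notation K := (scalars ax).
Local Notation B := (loc_biproducts ax).
Local Notation zero X Y := (bizero B X Y).

HB.instance Definition _ := Choice.copy K (loc_hom ax II II).

Lemma loc_addE (X Y : C) (f g : hom X Y) : loc_add f g = biadd B f g.
Proof. by []. Qed.

Lemma loc_inverse (a : K) : exists b : K,
  (a <> zero I I -> b ∘ a = \1_I) /\ (a = zero I I -> b = zero I I).
Proof.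
have [a0|a0] := pselect (a = zero I I); first by exists (zero I I); split.
have [s s0 [a1 as1]] := loc_clear a.
have [t st] := loc_scalar_inv s0.
have a10 : a1 <> hzero hO _ _.
  move=> e; apply: a0; apply: (loc_scalar_epi s0); rewrite as1 e.
  by rewrite (zerof B).
have [t1 st1] := loc_scalar_inv a10.
exists (U s ∘ t1); split=> // _.
by rewrite loc_scalarC hcompA as1 st1.
Qed.

(** For [k] killed by [d†], the scalars [u] and [v] below sum to [d† k = 0] and
    are nonzero, so [u^-1 v] is the opposite of 1. *)
Lemma loc_opposite : exists n : K, biadd B \1_I n = zero I I.
Proof.
have [d [k [d1 d2 k0 dk]]] := codiagonal_kernel ax.
pose u : K := U ((prj1 hO II II ∘ d)† ∘ (prj1 hO II II ∘ k)).
pose v : K := U ((prj2 hO II II ∘ d)† ∘ (prj2 hO II II ∘ k)).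
have uv : biadd B u v = zero I I.
  have -> : zero I I = (U d : hom I _)† ∘ U k.
    by rewrite -loc_map_dag -loc_mapM dk.
  have e : U d = bipair B (U (prj1 hO II II ∘ d)) (U (prj2 hO II II ∘ d)).
    by apply: (p_monic (d := B)); rewrite ?p1_pair ?p2_pair !loc_mapM.
  have e' : U k = bipair B (U (prj1 hO II II ∘ k)) (U (prj2 hO II II ∘ k)).
    by apply: (p_monic (d := B)); rewrite ?p1_pair ?p2_pair !loc_mapM.
  rewrite e e' (@dag_pair_pair _ B _ I I).
  by congr (biadd B _ _); rewrite -loc_map_dag -loc_mapM.
have u0 : u <> zero I I.
  move=> u0; have v0 : v = zero I I by rewrite -uv u0 biadd0f.
  apply: k0; apply: (prj_jointly_monic (ax := ax)); rewrite compf0.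
    apply: (scalar_monic (scalar_neq0_dag d1)); rewrite compf0.
    exact: loc_map_inj u0.
  apply: (scalar_monic (scalar_neq0_dag d2)); rewrite compf0.
  exact: loc_map_inj v0.
have [t [/(_ u0) tu _]] := loc_inverse u; exists (t ∘ v).
by rewrite -tu -biadd_compl uv fzero.
Qed.

Definition loc_inv (a : K) : K := projT1 (cid (loc_inverse a)).
Definition loc_opp (a : K) : K := projT1 (cid loc_opposite) ∘ a.

Lemma loc_addA : associative (@loc_add D ax I I).
Proof. by move=> a b c; rewrite !loc_addE biaddA. Qed.

Lemma loc_addC : commutative (@loc_add D ax I I).
Proof. by move=> a b; rewrite !loc_addE biaddC. Qed.

Lemma loc_add0 : left_id (zero I I) (@loc_add D ax I I).
Proof. by move=> a; rewrite loc_addE biadd0f. Qed.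

Lemma loc_addN : left_inverse (zero I I) loc_opp (@loc_add D ax I I).
Proof.
move=> a; rewrite loc_addE biaddC /loc_opp; case: (cid _) => n e.
by rewrite -{1}[a]hcomp1f -biadd_compr e zerof.
Qed.

HB.instance Definition _ :=
  GRing.isZmodule.Build K loc_addA loc_addC loc_add0 loc_addN.

Definition loc_mul (a b : K) : K := a ∘ b.

Lemma loc_mulA : associative loc_mul.
Proof. by move=> a b c; rewrite /loc_mul hcompA. Qed.

Lemma loc_mul1 : left_id (\1_I : K) loc_mul.
Proof. by move=> a; exact: hcomp1f. Qed.

Lemma loc_mulDl : left_distributive loc_mul (@loc_add D ax I I).
Proof. by move=> a b c; rewrite /loc_mul !loc_addE biadd_compr. Qed.

Lemma loc_one_neq0 : (\1_I : K) != 0%R.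
Proof. by apply/eqP => /loc_map_inj /(id_neq0). Qed.

HB.instance Definition _ := GRing.Zmodule_isComNzRing.Build K
  loc_mulA (@loc_scalarC D ax) loc_mul1 loc_mulDl loc_one_neq0.

Lemma loc_mulVf (a : K) : a != 0%R -> (loc_inv a * a = 1)%R.
Proof. by move=> /eqP a0; rewrite /loc_inv; case: (cid _) => b /= [/(_ a0)]. Qed.

Lemma loc_inv0 : loc_inv 0%R = 0%R.
Proof. by rewrite /loc_inv; case: (cid _) => b /= [_ /(_ erefl)]. Qed.

HB.instance Definition _ := GRing.ComNzRing_isField.Build K loc_mulVf loc_inv0.

End ScalarRing.

(** * Positive scalars and domination by contractions *)

Section Positive.
Variables (D : dagger_rig) (ax : rig_axioms D).
Local Notation hO := (O_terminal ax).
Local Notation C := (localisation ax).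
Local Notation U := (@loc_functor D ax _ _).
Local Notation I := (II : C).
Local Notation K := (scalars ax).
Local Notation B := (loc_biproducts ax).
Local Notation zero X Y := (bizero B X Y).

Definition conj_scalar (a : K) : K := a†.

(** The squared norm of a vector. *)
Definition gram (X : C) (x : hom I X) : K := x† ∘ x.

Lemma conj_scalarD (a b : K) :
  conj_scalar (a + b)%R = (conj_scalar a + conj_scalar b)%R.
Proof. exact: (biadd_dag B). Qed.

Lemma conj_scalarM (a b : K) :
  conj_scalar (a * b)%R = (conj_scalar a * conj_scalar b)%R.
Proof. by rewrite GRing.mulrC; exact: dagM. Qed.

Lemma conj_scalarK (a : K) : conj_scalar (conj_scalar a) = a. Proof. exact: dagK. Qed.

Lemma conj_scalar1 : conj_scalar 1%R = 1%R. Proof. exact: dag1. Qed.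

Lemma gram_scale (X : C) (x : hom I X) (s : K) :
  gram (x ∘ s) = (conj_scalar s * s * gram x)%R.
Proof.
have -> : gram (x ∘ s) = s† ∘ (gram x ∘ s) by rewrite /gram dagM !hcompA.
by rewrite GRing.mulrAC -GRing.mulrA.
Qed.

Lemma conj_scalar_gram (X : C) (x : hom I X) : conj_scalar (gram x) = gram x.
Proof. by rewrite /conj_scalar /gram dagM dagK. Qed.

Lemma gram_functor (X : D) (x : hom (II : D) X) : gram (U x) = U (x† ∘ x).
Proof. by rewrite loc_mapM loc_map_dag. Qed.

Lemma gram_eq0 (X : C) (x : hom I X) : gram x = 0%R -> x = zero I X.
Proof.
move=> x0; have [s s0 [y xs]] := loc_clear x.
apply: (loc_scalar_epi s0); rewrite xs (zerof B) (_ : y = hzero hO II X) //.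
apply: dag_comp_eq0; apply: (@loc_map_inj _ ax).
by rewrite -gram_functor -xs gram_scale x0 GRing.mulr0.
Qed.

Lemma U_scalar_neq0 (s : hom (II : D) II) :
  s <> hzero hO _ _ -> (U s : K) != 0%R.
Proof. by move=> s0; apply/eqP => /loc_map_inj. Qed.

Lemma conj_scalar_eq0 (a : K) : (conj_scalar a == 0%R) = (a == 0%R).
Proof.
have conj_scalar0 : conj_scalar 0%R = 0%R.
  by change ((zero I I)† = zero I I); exact: loc_dag0.
by apply/eqP/eqP => [h|->//]; rewrite -[a]conj_scalarK h.
Qed.

(** Vectors of equal norm differ by a partial isometry, and it is a contraction
    even when the vectors are not. *)
Lemma gram_cofactor (X Y : C) (x : hom I X) (y : hom I Y) :
  gram x = gram y -> exists h : hom (Y : D) X, x = U h ∘ y.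
Proof.
move=> xy; have [s s0 [x0 xs]] := loc_clear x; have [t t0 [y0 yt]] := loc_clear y.
(* A common denominator brings both vectors into the contractions. *)
have xst : x ∘ U (s ∘ t) = U (x0 ∘ t) by rewrite !loc_mapM hcompA xs.
have yst : y ∘ U (s ∘ t) = U (y0 ∘ s) by rewrite scalarC !loc_mapM hcompA yt.
have [|h e] := gram_factor ax (x := x0 ∘ t) (y := y0 ∘ s).
  by apply: (@loc_map_inj _ ax); rewrite -!gram_functor -xst -yst !gram_scale xy.
exists h; apply: (loc_scalar_epi (scalar_neq0M s0 t0)).
by rewrite xst e -hcompA yst loc_mapM.
Qed.

Definition dominated (a b : K) : Prop :=
  exists (X Y : C) (x : hom I X) (y : hom I Y) (f : hom (Y : D) X),
    [/\ a = gram x, b = gram y & x = U f ∘ y].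

(** Domination may be tested on any vectors representing the two scalars, by
    [gram_cofactor]. *)
Lemma dominated_gram (X Y : C) (x : hom I X) (y : hom I Y) :
  dominated (gram x) (gram y) <-> exists f : hom (Y : D) X, x = U f ∘ y.
Proof.
split=> [[X' [Y' [x' [y' [f [ex ey xy]]]]]]|[f e]]; last by exists X, Y, x, y, f.
have [g ->] := gram_cofactor ex; have [h yh] := gram_cofactor (esym ey).
by exists (g ∘ f ∘ h); rewrite !loc_mapM xy yh !hcompA.
Qed.

Definition positive (a : K) : Prop := exists (X : C) (x : hom I X), a = gram x.

Lemma dominated_positive a b : dominated a b -> positive a /\ positive b.
Proof.
by move=> [X [Y [x [y [f [-> -> _]]]]]]; split; [exists X, x | exists Y, y].
Qed.

Lemma dominated_trans a b c : dominated a b -> dominated b c -> dominated a c.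
Proof.
move=> ab bc; have [[X [x ax0]] [Y [y by0]]] := dominated_positive ab.
have [_ [Z [z cz]]] := dominated_positive bc; subst a b c.
move: ab bc => /dominated_gram [f ->] /dominated_gram [g ->]; apply/dominated_gram.
by exists (f ∘ g); rewrite loc_mapM hcompA.
Qed.

Lemma gram_pair (X Y : C) (x : hom I X) (y : hom I Y) :
  gram (bipair B x y) = (gram x + gram y)%R.
Proof. exact: (dag_pair_pair B). Qed.

Lemma positive_add a b : positive a -> positive b -> positive (a + b)%R.
Proof.
by move=> [X [x ->]] [Y [y ->]]; rewrite -gram_pair; exists (bisum B X Y), (bipair B x y).
Qed.

Lemma positive_anti (a : K) : positive a -> positive (- a)%R -> a = 0%R.
Proof.
move=> [X [x ex]] [Y [y ey]].
have /gram_eq0 e : gram (bipair B x y) = 0%R by rewrite gram_pair -ex -ey GRing.subrr.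
have -> : a = gram (biproj1 B X Y ∘ bipair B x y) by rewrite p1_pair.
by rewrite e (fzero B) /gram (fzero B).
Qed.

Lemma positive_star a : positive a -> conj_scalar a = a.
Proof. by move=> [X [x ->]]; exact: conj_scalar_gram. Qed.

Lemma positive_sq (a : K) : positive (conj_scalar a * a)%R.
Proof. by exists I, a. Qed.

(** [x] is the first projection of the pair [(x, y)], and the projection is a
    contraction. *)
Lemma dominated_add a b : positive a -> positive b -> dominated a (a + b)%R.
Proof.
move=> [X [x ->]] [Y [y ->]]; rewrite -gram_pair; apply/dominated_gram.
by exists (prj1 hO X Y); rewrite -[U _]/(biproj1 B X Y) p1_pair.
Qed.

Lemma dominatedD a b a' b' : dominated a b -> dominated a' b' ->
  dominated (a + a')%R (b + b')%R.
Proof.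
move=> [X [Y [x [y [f [-> -> e]]]]]] [X' [Y' [x' [y' [f' [-> -> e']]]]]].
rewrite -!gram_pair; apply/dominated_gram; exists (f ⊕ₘ f').
apply: (p_monic (d := B)); rewrite ?p1_pair ?p2_pair hcompA.
  by rewrite -loc_mapM prj1_nat loc_mapM -hcompA p1_pair.
by rewrite -loc_mapM prj2_nat loc_mapM -hcompA p2_pair.
Qed.

(** Tensoring with [z] multiplies norms by that of [z] and turns the contraction
    [f] into [1 ⊗ f]. The tensor product is used on contractions only, after
    the denominators [s] and [t] are cleared and then restored. *)
Lemma gram_tensor (Z Y : D) (z : hom I (Z : C)) (y : hom I (Y : C)) :
  exists w : hom I (Z ⊗ Y : C), gram w = (gram z * gram y)%R /\
    forall (X : D) (f : hom (Y : D) X),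
      gram (U (\1_(Z : D) ⊗ₘ f) ∘ w) = (gram z * gram (U f ∘ y))%R.
Proof.
have [s s0 [z0 zs]] := loc_clear z; have [t t0 [y0 yt]] := loc_clear y.
have [u su] := loc_scalar_inv s0; have [v tv] := loc_scalar_inv t0.
have key (X : D) (x : hom I (X : C)) (x0 : hom (II : D) X) : x ∘ U t = U x0 ->
    gram (U (pointed_tensor z0 x0) ∘ (u ∘ v)) = (gram z * gram x)%R.
  move=> xt; rewrite gram_scale gram_functor gram_pointed_tensor loc_mapM.
  rewrite -!gram_functor -zs -xt !gram_scale.
  have m (p q : K) : p ∘ q = (p * q)%R by [].
  rewrite !m !conj_scalarM.
  have e1 : ((U s : K) * u = 1)%R by exact: su.
  have e2 : ((U t : K) * v = 1)%R by exact: tv.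
  have e3 : (conj_scalar (U s) * conj_scalar u = 1)%R by rewrite -conj_scalarM e1 conj_scalar1.
  have e4 : (conj_scalar (U t) * conj_scalar v = 1)%R by rewrite -conj_scalarM e2 conj_scalar1.
  transitivity ((conj_scalar (U s) * conj_scalar u) *
    (conj_scalar (U t) * conj_scalar v) * ((U s : K) * u) * ((U t : K) * v) * (gram z * gram x))%R; first by ring.
  by rewrite e1 e2 e3 e4 !GRing.mul1r.
exists (U (pointed_tensor z0 y0) ∘ (u ∘ v)); split; first exact: key.
move=> X f; rewrite hcompA -loc_mapM -pointed_tensor_map; apply: key.
by rewrite -hcompA yt loc_mapM.
Qed.

Lemma positive_mul (a b : K) : positive a -> positive b -> positive (a * b)%R.
Proof.
move=> [Z [z ->]] [Y [y ->]]; have [w [<- _]] := gram_tensor z y.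
by exists ((Z : D) ⊗ Y : C), w.
Qed.

Lemma dominatedM c a b : positive c -> dominated a b -> dominated (c * a)%R (c * b)%R.
Proof.
move=> [Z [z ->]] [X [Y [x [y [f [-> -> ->]]]]]].
have [w [<- e]] := gram_tensor z y; rewrite -e; apply/dominated_gram.
by exists (\1_(Z : D) ⊗ₘ f).
Qed.

(** Fixing one denominator [s] lets a whole bounded sequence of scalars be
    represented by contractions: [c a] is the norm of a vector of the original
    category, where the colimit axiom lives. *)
Section Scaled.
Variables (s : hom (II : D) II) (s0 : s <> hzero hO _ _).
Local Notation c := (conj_scalar (U s) * U s : K)%R.

Lemma scale_neq0 : c != 0%R.
Proof. by rewrite GRing.mulf_neq0 ?conj_scalar_eq0 ?U_scalar_neq0. Qed.

Lemma scaled_gram X (x : hom (II : D) X) (a : K) : U (x† ∘ x) = (c * a)%R ->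
  exists2 y : hom I (X : C), y ∘ U s = U x & a = gram y.
Proof.
move=> xa; have [u su] := loc_scalar_inv s0; exists (U x ∘ u).
  by rewrite -hcompA [u ∘ _](loc_scalarC u) su hcompf1.
rewrite gram_scale gram_functor xa.
have e1 : ((U s : K) * u = 1)%R by exact: su.
have e3 : (conj_scalar (U s) * conj_scalar u = 1)%R by rewrite -conj_scalarM e1 conj_scalar1.
transitivity ((conj_scalar (U s) * conj_scalar u) * ((U s : K) * u) * a)%R; last by ring.
by rewrite e1 e3 !GRing.mul1r.
Qed.

Lemma dominated_scaled X Y (x : hom (II : D) X) (y : hom (II : D) Y) (a b : K) :
  U (x† ∘ x) = (c * a)%R -> U (y† ∘ y) = (c * b)%R ->
  (dominated a b <-> exists f, x = f ∘ y).
Proof.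
move=> /scaled_gram[x' xx ->] /scaled_gram[y' yy ->]; apply: (iff_trans (dominated_gram _ _)).
split=> -[f e]; exists f.
  by apply: (@loc_map_inj _ ax); rewrite -xx e loc_mapM -yy hcompA.
by apply: (loc_scalar_epi s0); rewrite -hcompA yy xx e loc_mapM.
Qed.

(** Whatever is dominated by a scalar with denominator [s] has denominator [s],
    because the contraction [f] has none; passing to the image makes the
    representing vector epic. *)
Lemma dominated_epic X (x : hom (II : D) X) (a b : K) :
  U (x† ∘ x) = (c * b)%R -> dominated a b ->
  exists (E : D) (e : hom (II : D) E), epic e /\ U (e† ∘ e) = (c * a)%R.
Proof.
move=> xb ab; have [x' xx eb] := scaled_gram xb.
have [[Y [y ay]] _] := dominated_positive ab; subst a b.
have /dominated_gram[f yf] := ab.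
have [E [m [e [mm ee fx]]]] := image_factorisation ax (f ∘ x).
exists E, e; split=> //; rewrite -gram_scale yf -hcompA xx -loc_mapM gram_functor.
by rewrite fx dagM -!hcompA [m† ∘ _]hcompA mm hcomp1f.
Qed.

End Scaled.

Lemma positive_scaled b : positive b -> exists2 s : hom (II : D) II, s <> hzero hO _ _ &
  exists X (x : hom (II : D) X), U (x† ∘ x) = (conj_scalar (U s) * U s * b)%R.
Proof.
move=> [X [x ->]]; have [s s0 [y xs]] := loc_clear x; exists s => //.
by exists X, y; rewrite -gram_functor -xs gram_scale.
Qed.

Lemma dominated_refl a : positive a -> dominated a a.
Proof.
move=> [X [x ->]]; apply/dominated_gram; exists \1_(X : D).
by rewrite [U _]/(\1_X) hcomp1f.
Qed.

Lemma dominated_anti a b : dominated a b -> dominated b a -> a = b.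
Proof.
move=> ab ba; have [_ pb] := dominated_positive ab.
have [s s0 [X [x xb]]] := positive_scaled pb.
have [E [e [ee ea]]] := dominated_epic s0 xb ab.
have [F [f [ef eb]]] := dominated_epic s0 xb (dominated_refl pb).
have [g eg] := (dominated_scaled s0 ea eb).1 ab.
have [h fh] := (dominated_scaled s0 eb ea).1 ba.
apply: (GRing.mulfI (scale_neq0 s0)).
by rewrite -ea -eb (mutual_factor_gram ax ee ef eg fh).
Qed.

(** Represent each [a n] by an epic vector [e n] with the denominator of [a 0].
    Domination yields contractions [f n] with [e n.+1 = f n ∘ e n], and lower
    bounds correspond to cocones under the diagram of the [f n]. The vector that
    the [e n] induce in the colimit represents the infimum. The lower bound [l]
    provides the monic cocone that the boundedness axiom requires. *)
Lemma dominated_inf (a : nat -> K) (l : K) : l != 0%R ->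
  (forall n, dominated (a n.+1) (a n)) -> (forall n, dominated l (a n)) ->
  exists2 t, forall n, dominated t (a n) &
    forall m, (forall n, dominated m (a n)) -> dominated m t.
Proof.
move=> l0 adec la; have [_ pa0] := dominated_positive (la 0%N).
have [s s0 [X [x xa]]] := positive_scaled pa0.
have a0 n : dominated (a n) (a 0%N).
  by elim: n => [|n IHn]; [exact: dominated_refl | exact: dominated_trans IHn].
pose E n := projT1 (cid (dominated_epic s0 xa (a0 n))).
pose e n : hom (II : D) (E n) := projT1 (cid (projT2 (cid (dominated_epic s0 xa (a0 n))))).
have [ee ea] : (forall n, epic (e n)) /\
    forall n, U ((e n)† ∘ e n) = (conj_scalar (U s) * U s * a n)%R.
  by split=> n; have [] := projT2 (cid (projT2 (cid (dominated_epic s0 xa (a0 n))))).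
have H n : exists f : hom (E n) (E n.+1), e n.+1 = f ∘ e n.
  exact: (dominated_scaled s0 (ea _) (ea _)).1 (adec n).
pose f n := projT1 (cid (H n)).
have fe n : e n.+1 = f n ∘ e n by exact: projT2 (cid (H n)).
have lift m : (forall n, dominated m (a n)) -> exists (Y : D) (y : hom (II : D) Y),
    U (y† ∘ y) = (conj_scalar (U s) * U s * m)%R /\
    exists2 g : forall n, hom (E n) Y, cocone f g & forall n, y = g n ∘ e n.
  move=> ma; have [Y [y [ey ym]]] := dominated_epic s0 xa (ma 0%N).
  exists Y, y; split=> //.
  have G n : exists g : hom (E n) Y, y = g ∘ e n.
    exact: (dominated_scaled s0 ym (ea _)).1 (ma n).
  exists (fun n => projT1 (cid (G n))) => n; last exact: projT2 (cid (G n)).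
  apply: (ee n); rewrite -hcompA -fe.
  by rewrite -(projT2 (cid (G n))) -(projT2 (cid (G n.+1))).
have [L [c [cc cu]]] : has_colimit f.
  apply: (bounded_colimits ax); have [Y [y [yl [g gc yg]]]] := lift l la.
  exists Y, g; split=> // n Z p q gpq; apply: dag_inj; apply: (ee n).
  (* As [y† y] is a nonzero scalar, [y] is monic; so is [g n], because
     [e n] is invertible up to the scalar [e n† e n]. *)
  have ym : monic y.
    move=> W u v yuv; apply: (scalar_monic (ax := ax) (a := y† ∘ y)).
      move=> yy0; have /eqP := yl; rewrite yy0 eq_sym.
      by apply/negP; exact: GRing.mulf_neq0 (scale_neq0 s0) l0.
    by rewrite -!hcompA yuv.
  have key (r : hom Z (E n)) :
      y ∘ ((e n)† ∘ r) = smul ((e n)† ∘ e n) (g n ∘ r).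
    rewrite (yg n) -hcompA [e n ∘ _]hcompA (epic_cogram (ee n)) -smul_compl.
    by rewrite hcomp1f -smul_compr.
  apply: dag_inj; rewrite ![((_)† ∘ _)†]dagM !dagK; apply: ym.
  by rewrite !key gpq.
have ce n : c n ∘ e n = c 0%N ∘ e 0%N.
  by elim: n => // n IHn; rewrite fe hcompA cc.
have ct : U ((c 0%N ∘ e 0%N)† ∘ (c 0%N ∘ e 0%N)) = (conj_scalar (U s) * U s *
    ((conj_scalar (U s) * U s)^-1 * gram (U (c 0%N ∘ e 0%N))))%R.
  by rewrite GRing.mulVKf ?scale_neq0 // gram_functor.
exists ((conj_scalar (U s) * U s)^-1 * gram (U (c 0%N ∘ e 0%N)))%R => [n|m ma].
  by apply/(dominated_scaled s0 ct (ea n)); exists (c n).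
have [Y [y [ym [g gc yg]]]] := lift m ma.
apply/(dominated_scaled s0 ym ct); have [u [ug _]] := cu Y g gc.
by exists u; rewrite (yg 0%N) hcompA ug.
Qed.

End Positive.

Import Order.TTheory GRing.Theory Num.Theory.
Local Open Scope ring_scope.

(** * Ordered fields with infima of decreasing sequences are the reals *)

(** A positive lower bound loses no generality, since sequences may be
    translated. *)
Definition has_decreasing_infima (F : realFieldType) :=
  forall (a : nat -> F) (l : F), 0 < l ->
    (forall n, a n.+1 <= a n) -> (forall n, l <= a n) ->
    exists2 t, forall n, t <= a n & forall m, (forall n, m <= a n) -> m <= t.

Section Comparison.
Variables (F : realFieldType) (Finf : has_decreasing_infima F) (R : realType).

(** If [x] exceeded every natural number, the inverses [1 / n] would have a
    positive infimum [t]; but [2 t] is again a lower bound. *)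
Lemma decreasing_infima_archimedean (x : F) : exists n : nat, x <= n%:R.
Proof.
apply: contrapT => /forallNP h; have {}h n : n%:R < x.
  by rewrite ltNge; apply/negP/h.
have x0 : 0 < x by exact: (h 0%N).
have [||n|t ta tm] := Finf (a := fun n => n.+1%:R^-1) (l := x^-1).
- by rewrite invr_gt0.
- by move=> n; rewrite lef_pV2 ?posrE ?ltr0n // ler_nat.
- by rewrite lef_pV2 ?posrE ?ltr0n // ltW.
have t0 : 0 < t.
  apply: (@lt_le_trans _ _ x^-1); first by rewrite invr_gt0.
  by apply: tm => n; rewrite lef_pV2 ?posrE ?ltr0n // ltW.
suff : t *+ 2 <= t by move=> ?; lra.
apply: tm => n; have := ta (n.*2.+1).
rewrite -doubleS -muln2 natrM invfM => ht.
by rewrite mulr2n; move: (n.+1%:R^-1) ht => z ht; lra.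
Qed.

Definition cut (x : F) : set R := [set ratr q | q in [set q : rat | ratr q <= x]]%classic.
Definition cut_sup (x : F) : R := sup (cut x).

Lemma has_sup_cut x : has_sup (cut x).
Proof.
have [n xn] := decreasing_infima_archimedean x.
have [m xm] := decreasing_infima_archimedean (- x).
split.
  exists (ratr (- m%:R)), (- m%:R) => //=; rewrite rmorphN rmorph_nat; lra.
exists (ratr n%:R) => _ [q /= qx <-]; rewrite ler_rat -(ler_rat F) rmorph_nat.
exact: le_trans xn.
Qed.

Lemma le_cut_sup (q : rat) x : ratr q <= x -> ratr q <= cut_sup x.
Proof. by move=> qx; apply: sup_ubound; [exact: (has_sup_cut x).2|exists q]. Qed.

Lemma cut_sup_le (q : rat) x : x <= ratr q -> cut_sup x <= ratr q.
Proof.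
move=> xq; apply: sup_le_ub; first exact: (has_sup_cut x).1.
move=> _ [p /= px <-]; rewrite ler_rat -(ler_rat F); exact: le_trans xq.
Qed.

Lemma lt_cut_sup (q : rat) x : cut_sup x < ratr q -> x < ratr q.
Proof. by move=> h; rewrite ltNge; apply/negP => /le_cut_sup; rewrite leNgt h. Qed.

Lemma cut_sup_lt (q : rat) x : ratr q < cut_sup x -> ratr q < x.
Proof. by move=> h; rewrite ltNge; apply/negP => /cut_sup_le; rewrite leNgt h. Qed.

Lemma rat_between (a b : R) : a < b -> exists q : rat, a < ratr q < b.
Proof.
by move=> ab; have [q] := rat_in_itvoo ab; rewrite in_itv /=; exists q.
Qed.

(** A real number is determined by the rationals on either side of it. This
    reduces each algebraic law for [cut_sup] to rational approximation. *)
Lemma cut_sup_unique x (r : R) :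
  (forall q : rat, ratr q <= x -> ratr q <= r) ->
  (forall q : rat, x <= ratr q -> r <= ratr q) -> cut_sup x = r.
Proof.
move=> h1 h2; apply/eqP; rewrite eq_le; apply/andP; split.
  rewrite leNgt; apply/negP => /rat_between[q /andP[rq /cut_sup_lt/ltW/h1]].
  by rewrite leNgt rq.
rewrite leNgt; apply/negP => /rat_between[q /andP[/lt_cut_sup/ltW/h2]].
by rewrite leNgt => /negbTE ->.
Qed.

Lemma cut_sup_rat (q : rat) : cut_sup (ratr q) = ratr q.
Proof. by apply: cut_sup_unique => p; rewrite !ler_rat. Qed.

Lemma cut_supD x y : cut_sup (x + y) = cut_sup x + cut_sup y.
Proof.
apply: cut_sup_unique => q qxy.
  rewrite leNgt; apply/negP => h.
  have [|a /andP[xa aq]] := @rat_between (cut_sup x) (ratr q - cut_sup y); first lra.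
  have yb : cut_sup y < ratr (q - a) by rewrite rmorphB /=; lra.
  by have := lt_cut_sup xa; have := lt_cut_sup yb; rewrite rmorphB /=; lra.
rewrite leNgt; apply/negP => h.
have [|a /andP[aq xa]] := @rat_between (ratr q - cut_sup y) (cut_sup x); first lra.
have yb : ratr (q - a) < cut_sup y by rewrite rmorphB /=; lra.
by have := cut_sup_lt xa; have := cut_sup_lt yb; rewrite rmorphB /=; lra.
Qed.

Lemma cut_sup0 : cut_sup 0 = 0.
Proof. by have := cut_sup_rat 0; rewrite !rmorph0. Qed.

Lemma cut_supN x : cut_sup (- x) = - cut_sup x.
Proof. by apply/eqP; rewrite -addr_eq0 -cut_supD addNr cut_sup0. Qed.

Lemma cut_sup_gt0 x : 0 < x -> 0 < cut_sup x.
Proof.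
move=> x0; have [n xn] := decreasing_infima_archimedean x^-1.
have n0 : (0 : F) < n%:R by apply: lt_le_trans xn; rewrite invr_gt0.
have : ratr n%:R^-1 <= x by rewrite fmorphV rmorph_nat -[x]invrK lef_pV2 ?posrE ?invr_gt0.
move=> /le_cut_sup; apply: lt_le_trans.
by rewrite ltr0q invr_gt0 -(ltr0q F) rmorph_nat.
Qed.

Lemma cut_supM_gt0 x y : 0 < x -> 0 < y -> cut_sup (x * y) = cut_sup x * cut_sup y.
Proof.
move=> x0 y0; have cx := cut_sup_gt0 x0; have cy := cut_sup_gt0 y0.
apply: cut_sup_unique => q qxy.
  rewrite leNgt; apply/negP => h.
  have [|a /andP[xa aq]] := @rat_between (cut_sup x) (ratr q / cut_sup y).
    by rewrite ltr_pdivlMr.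
  have a0 : 0 < ratr a :> R by exact: lt_trans xa.
  have yb : cut_sup y < ratr (q / a).
    by rewrite fmorph_div /= ltr_pdivlMr // mulrC -ltr_pdivlMr.
  have := ltr_pM (ltW x0) (ltW y0) (lt_cut_sup xa) (lt_cut_sup yb).
  rewrite -rmorphM /= [a * _]mulrC divfK ?ltNge ?qxy // gt_eqF //.
  by rewrite -(ltr0q R).
rewrite leNgt; apply/negP => h.
have q0 : 0 < ratr q :> F by exact: lt_le_trans (mulr_gt0 x0 y0) qxy.
have q0R : 0 < ratr q :> R by move: q0; rewrite !ltr0q.
have [|a /andP[aq xa]] := @rat_between (ratr q / cut_sup y) (cut_sup x).
  by rewrite ltr_pdivrMr.
have a0 : 0 < ratr a :> R by apply: lt_trans aq; rewrite divr_gt0.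
have yb : ratr (q / a) < cut_sup y.
  by rewrite fmorph_div /= ltr_pdivrMr // mulrC -ltr_pdivrMr.
have a0F : 0 < ratr a :> F by move: a0; rewrite !ltr0q.
have b0F : 0 < ratr (q / a) :> F by rewrite fmorph_div divr_gt0.
have := ltr_pM (ltW a0F) (ltW b0F) (cut_sup_lt xa) (cut_sup_lt yb).
rewrite -rmorphM /= [a * _]mulrC divfK ?ltNge ?qxy // gt_eqF //.
by rewrite -(ltr0q R).
Qed.

Lemma cut_supM x y : cut_sup (x * y) = cut_sup x * cut_sup y.
Proof.
wlog x0 : x / 0 < x => [hw|].
  case: (ltgtP x 0) => [x0|/hw//|->]; last by rewrite mul0r cut_sup0 mul0r.
  by apply: oppr_inj; rewrite -cut_supN -mulNr hw ?oppr_gt0 // cut_supN mulNr.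
case: (ltgtP y 0) => [y0|y0|->]; last by rewrite mulr0 cut_sup0 mulr0.
  apply: oppr_inj; rewrite -cut_supN -mulrN cut_supM_gt0 ?oppr_gt0 //.
  by rewrite cut_supN mulrN.
exact: cut_supM_gt0.
Qed.

Lemma cut_sup_ge0 x : (0 <= cut_sup x) = (0 <= x).
Proof.
apply/idP/idP; last by rewrite le0r => /predU1P[->|/cut_sup_gt0/ltW//]; rewrite cut_sup0.
apply: contraTT; rewrite -!ltNge -!oppr_gt0 -cut_supN; exact: cut_sup_gt0.
Qed.

Lemma cut_sup_inj : injective cut_sup.
Proof.
move=> x y xy; have e : cut_sup (x - y) = 0 by rewrite cut_supD cut_supN xy subrr.
apply/eqP; rewrite -subr_eq0 eq_le -oppr_ge0 -!cut_sup_ge0 cut_supN e oppr0.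
by rewrite lexx.
Qed.

(** A decreasing sequence of rationals converging to [r] from above has an
    infimum in [F], with the same rational cut as [r]. *)
Lemma cut_sup_surj_gt0 (r : R) : 0 < r -> exists x, cut_sup x = r.
Proof.
move=> r0.
have H n : exists q : rat, r < ratr q < r + n.+1%:R^-1.
  by apply: rat_between; rewrite ltrDl invr_gt0.
pose q n := projT1 (cid (H n)).
have [rq qr] : (forall n, r < ratr (q n)) /\ (forall n, ratr (q n) < r + n.+1%:R^-1).
  by split=> n; have /andP[] := projT2 (cid (H n)).
(* The running minimum of the approximations, to make them decrease. *)
pose a := fix a n := if n is m.+1 then Num.min (a m) (q m.+1) else q 0%N.
have ra n : r < ratr (a n).
  by elim: n => [|n IHn] /=; [exact: rq|rewrite minEle; case: ifP].
have aq n : a n <= q n by case: n => //= n; rewrite ge_min lexx orbT.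
have ar (p : rat) : (forall n, p <= a n) -> ratr p <= r.
  move=> pa; apply/ler_addgt0Pr => e e0.
  have [n ne] : exists n : nat, n.+1%:R^-1 < e.
    exists (Num.truncn e^-1); rewrite invf_plt ?posrE ?ltr0n //.
    exact: truncnS_gt.
  apply: le_trans (_ : ratr (q n) <= _).
    by rewrite ler_rat (le_trans (pa n)).
  by rewrite ltW // (lt_trans (qr n)) // ltrD2l.
have [l /andP[l0 lr]] := rat_between r0.
have la (p : rat) n : ratr p < r -> p < a n.
  by move=> pr; rewrite -(ltr_rat R) (lt_trans pr).
have [|n|n|t ta tm] := Finf (a := fun n => ratr (a n)) (l := ratr l).
- by move: l0; rewrite !ltr0q.
- by rewrite ler_rat /= ge_min lexx.
- by rewrite ler_rat ltW // la.
exists t; apply: cut_sup_unique => p pt.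
  by apply: ar => n; rewrite -(ler_rat F) (le_trans pt).
rewrite leNgt; apply/negP => /rat_between[p' /andP[pp' p'r]].
have := tm (ratr p'); move: pp'; rewrite ltr_rat -(ltr_rat F) => pp' h.
have : ratr p' <= t by apply: h => n; rewrite ler_rat ltW // la.
by move=> /le_trans/(_ pt); rewrite leNgt pp'.
Qed.

Lemma cut_sup_surj (r : R) : exists x, cut_sup x = r.
Proof.
have [/cut_sup_surj_gt0//|] := ltP 0 r; rewrite le_eqVlt => /predU1P[->|].
  by exists 0; rewrite cut_sup0.
rewrite -oppr_gt0 => /cut_sup_surj_gt0[x xr].
by exists (- x); rewrite cut_supN xr opprK.
Qed.

End Comparison.

(** * Square roots and totality of the order *)

(** An involutive field with a cone [pos] and a second order [prec] on the cone,
    which contains the order of the cone ([prec_add]) and has infima of bounded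
    decreasing sequences. Subtraction is not assumed to respect [prec]; that is
    a consequence of [prec_subE]. *)
Record star_field := StarField {
  sf_field :> fieldType;
  star : sf_field -> sf_field;
  pos : sf_field -> Prop;
  prec : sf_field -> sf_field -> Prop;
  starD : forall a b, star (a + b) = star a + star b;
  starM : forall a b, star (a * b) = star a * star b;
  starK : forall a, star (star a) = a;
  pos_star : forall a, pos a -> star a = a;
  pos_sq : forall a, pos (star a * a);
  posD : forall a b, pos a -> pos b -> pos (a + b);
  posM : forall a b, pos a -> pos b -> pos (a * b);
  pos_anti : forall a, pos a -> pos (- a) -> a = 0;
  prec_pos : forall a b, prec a b -> pos a /\ pos b;
  prec_trans : forall a b c, prec a b -> prec b c -> prec a c;
  prec_anti : forall a b, prec a b -> prec b a -> a = b;
  prec_add : forall a b, pos a -> pos b -> prec a (a + b);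
  precD : forall a b a' b', prec a b -> prec a' b' -> prec (a + a') (b + b');
  precM : forall c a b, pos c -> prec a b -> prec (c * a) (c * b);
  prec_inf : forall (a : nat -> sf_field) l, l != 0 ->
    (forall n, prec (a n.+1) (a n)) -> (forall n, prec l (a n)) ->
    exists2 t, forall n, prec t (a n) &
      forall m, (forall n, prec m (a n)) -> prec m t }.

Section StarField.
Variable K : star_field.
Implicit Types a b c t l m : K.
Local Notation star := (@star K).
Local Notation pos := (@pos K).
Local Notation prec := (@prec K).

Lemma star0 : star 0 = 0.
Proof. by apply: (addIr (star 0)); rewrite -starD !add0r. Qed.

Lemma star1 : star 1 = 1.
Proof. by rewrite -[RHS](starK 1) -{2}[star 1]mulr1 starM starK mul1r. Qed.

Lemma starN a : star (- a) = - star a.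
Proof. by apply/eqP; rewrite -addr_eq0 -starD addNr star0. Qed.

Lemma star_eq0 a : (star a == 0) = (a == 0).
Proof. by apply/eqP/eqP => [h|->]; [rewrite -[a]starK h|]; rewrite star0. Qed.

Lemma starV a : star a^-1 = (star a)^-1.
Proof.
have [->|a0] := eqVneq a 0; first by rewrite invr0 star0 invr0.
by apply: (mulIf (x := star a)); rewrite ?star_eq0 // -starM !mulVf ?star_eq0 // star1.
Qed.

Lemma pos0 : pos 0. Proof. by have := pos_sq (0 : K); rewrite mulr0. Qed.
Lemma pos1 : pos 1. Proof. by have := pos_sq (1 : K); rewrite star1 mulr1. Qed.

Lemma pos_nat n : pos n%:R.
Proof. by elim: n => [|n IHn]; [exact: pos0|rewrite -natr1; exact: posD IHn pos1]. Qed.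

Lemma posV a : pos a -> pos a^-1.
Proof.
move=> pa; have [->|a0] := eqVneq a 0; first by rewrite invr0; exact: pos0.
have -> : a^-1 = a * (star a^-1 * a^-1) by rewrite starV (pos_star pa) mulVKf.
exact: posM pa (pos_sq _).
Qed.

Lemma posf a b : pos a -> pos b -> pos (a / b).
Proof. by move=> pa pb; exact: posM pa (posV pb). Qed.

Lemma posD_eq0 a b : pos a -> pos b -> a + b = 0 -> a = 0.
Proof.
move=> pa pb /eqP; rewrite addr_eq0 => /eqP e.
by move: pb; rewrite -[b]opprK -e => /(pos_anti pa).
Qed.

Lemma posD_neq0 a b : pos a -> pos b -> b != 0 -> a + b != 0.
Proof. by move=> pa pb; apply: contra => /eqP; rewrite addrC => /(posD_eq0 pb pa) ->. Qed.

Lemma natr_neq0 n : n.+1%:R != 0 :> K.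
Proof. by rewrite -natr1 (posD_neq0 (pos_nat n) pos1) // oner_neq0. Qed.

Lemma prec_sub a b : pos a -> pos (b - a) -> prec a b.
Proof. by move=> pa pba; rewrite -[b](subrKC a); exact: prec_add. Qed.

Lemma prec_refl a : pos a -> prec a a.
Proof. by move=> pa; apply: prec_sub => //; rewrite subrr; exact: pos0. Qed.

Lemma prec0_eq a : prec a 0 -> a = 0.
Proof.
move=> a0; apply: prec_anti (a0) _; have [pa _] := prec_pos a0.
by rewrite -[a in prec _ a]add0r; exact: prec_add pos0 pa.
Qed.

Lemma precMl c a b : pos c -> c != 0 -> prec (c * a) (c * b) -> prec a b.
Proof.
by move=> pc c0 /(precM (posV pc)); rewrite !mulKf.
Qed.

Lemma precM2 a b a' b' : prec a b -> prec a' b' -> prec (a * a') (b * b').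
Proof.
move=> ab ab'; have [pa _] := prec_pos ab; have [_ pb'] := prec_pos ab'.
apply: prec_trans (precM pa ab') _; rewrite ![_ * b']mulrC; exact: precM.
Qed.

Definition infimum (a : nat -> K) t :=
  (forall n, prec t (a n)) /\ forall m, (forall n, prec m (a n)) -> prec m t.

(** As [prec] cannot be subtracted, addition of [c] is handled by ratios: from
    [t <= a n] follows [(c + a n) / (c + t) <= a n / t], so a lower bound [m] of
    [c + a n] satisfies [m t / (c + t) <= a n] for all [n]. *)
Lemma infimumD (a : nat -> K) t c : t != 0 -> pos c -> infimum a t ->
  infimum (fun n => c + a n) (c + t).
Proof.
move=> t0 pc [ta tm]; have [pt _] := prec_pos (ta 0%N).
split=> [n|m ma]; first exact: precD (prec_refl pc) (ta n).
have u0 : c + t != 0 by exact: posD_neq0.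
have pu : pos (c + t) by exact: posD.
have pr : pos (t / (c + t)) by exact: posf.
have r0 : t / (c + t) != 0 by rewrite mulf_neq0 ?invr_eq0.
apply: (precMl pr r0); rewrite divfK //; apply: tm => n.
apply: prec_trans (precM pr (ma n)) _.
apply: (precMl pu u0); rewrite mulrA [_ * (t / _)]mulrC divfK // mulrDl mulrDr.
apply: precD; rewrite mulrC; first exact: precM.
by apply/prec_refl/posM; have [] := prec_pos (ta n).
Qed.

Lemma pos_sqr a : star a = a -> pos (a ^+ 2).
Proof. by move=> sa; have := pos_sq a; rewrite sa. Qed.

Section Newton.
Variables (c : K) (pc : pos c) (c0 : c != 0).

(** The starting point [1 + c] is above the square root, as
    [(1 + c)^2 - c = 1 + c + c^2]; the iteration then decreases. *)
Fixpoint newton n : K :=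
  if n is m.+1 then (newton m + c / newton m) / 2%:R else 1 + c.

Lemma newton_pos n : pos (newton n) /\ newton n != 0.
Proof.
elim: n => [|n [pn n0]] /=.
  by split; [exact: posD pos1 pc|exact: posD_neq0 pos1 pc c0].
have h : pos (c / newton n) by exact: posf.
split; first exact: posf (posD pn h) (pos_nat 2).
rewrite mulf_neq0 ?invr_eq0 ?(natr_neq0 1) // posD_neq0 //.
by rewrite mulf_neq0 ?invr_eq0.
Qed.

Lemma newton_ge n : pos (newton n ^+ 2 - c).
Proof.
case: n => [|n] /=.
  have -> : (1 + c) ^+ 2 - c = 1 + c + c ^+ 2 by ring.
  by apply: posD (posD pos1 pc) _; exact: posM.
have [pn n0] := newton_pos n.
have -> : ((newton n + c / newton n) / 2%:R) ^+ 2 - c =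
    ((newton n - c / newton n) / 2%:R) ^+ 2.
  by field; rewrite n0 (natr_neq0 1).
apply: pos_sqr; rewrite starM starV starD starN starM starV.
by rewrite (pos_star pn) (pos_star pc) (pos_star (pos_nat 2)).
Qed.

Lemma newton_decr n : pos (newton n - newton n.+1).
Proof.
have [pn n0] := newton_pos n.
have -> : newton n - newton n.+1 = (newton n ^+ 2 - c) / (2%:R * newton n).
  by rewrite /=; field; rewrite n0 (natr_neq0 1).
exact: posf (newton_ge n) (posM (pos_nat 2) pn).
Qed.

Lemma newton_prec n : prec (newton n.+1) (newton n).
Proof. by apply: prec_sub (newton_decr n); case: (newton_pos n.+1). Qed.

Lemma newton_prec_add n k : prec (newton (n + k)) (newton k).
Proof.
elim: n => [|n IHn]; first exact: prec_refl (newton_pos k).1.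
exact: prec_trans (newton_prec _) IHn.
Qed.

(** The lower bound comes from [c / newton n <= newton n] and monotonicity. *)
Lemma newton_inf : exists2 t, infimum newton t & t != 0.
Proof.
have [p0 n0] := newton_pos 0.
have lb n : prec (c / newton 0) (newton n).
  have [pn nn0] := newton_pos n.
  apply: prec_trans (_ : prec (c / newton n) _).
    apply: precM => //; apply: (precMl pn nn0); rewrite mulfV //.
    apply: (precMl p0 n0); rewrite mulrCA mulfV // !mulr1.
    by have := newton_prec_add n 0; rewrite addn0.
  apply: prec_sub; first exact: posf.
  have -> : newton n - c / newton n = (newton n ^+ 2 - c) / newton n by field.
  exact: posf (newton_ge n) pn.
have l0 : c / newton 0 != 0 by rewrite mulf_neq0 ?invr_eq0.
have [t ta tm] := prec_inf l0 newton_prec lb.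
exists t; first by split.
by apply: contraNneq l0 => t0; apply/eqP/prec0_eq; rewrite -t0; apply: tm.
Qed.

(** Passing to the limit [t] in [2 x_{n+1} x_n = c + x_n^2] gives
    [2 t^2 = c + t^2]. *)
Lemma pos_sqrt : exists2 t, pos t & t ^+ 2 = c.
Proof.
have [t [ta tm] t0] := newton_inf; have [pt _] := prec_pos (ta 0%N).
exists t => //.
(* A lower bound [m] of the squares is below every product
   [newton n * newton k]; take infima over [n] and over [k] in turn. *)
have inf2 : infimum (fun n => newton n ^+ 2) (t ^+ 2).
  split=> [n|m ma]; first exact: precM2.
  have [pm _] := prec_pos (ma 0%N).
  rewrite -(divfK t0 m) expr2 mulrC; apply: precM => //.
  apply: (tm _) => k; have [pk k0] := newton_pos k.
  apply: (precMl pt t0); rewrite mulrC divfK // [t * _]mulrC.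
  rewrite -(divfK k0 m) [m / _ * _]mulrC; apply: precM => //; apply: (tm _) => n.
  apply: (precMl pk k0); rewrite mulrC divfK //.
  apply: prec_trans (ma (n + k)%N) _; apply: precM2 (newton_prec_add n k) _.
  by rewrite addnC; exact: newton_prec_add.
have t20 : t ^+ 2 != 0 by rewrite expf_neq0.
have pt2 : pos (t ^+ 2) by exact: posM.
have [ia im] := infimumD t20 pc inf2.
have step n : newton n.+1 * newton n * 2%:R = c + newton n ^+ 2.
  have [_ n0] := newton_pos n; rewrite /=; field; rewrite ?n0 ?(natr_neq0 1) //.
suff e : t ^+ 2 * 2%:R = c + t ^+ 2.
  by apply: (addIr (t ^+ 2)); rewrite -e; ring.
have p2 := pos_nat 2; have n2 := natr_neq0 1.
apply: prec_anti.
  apply: im => n; rewrite -step ![_ * 2%:R]mulrC; apply: precM => //.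
  exact: precM2.
rewrite [t ^+ 2 * _]mulrC -[c + _](divfK n2) [_ / _ * _]mulrC; apply: precM => //.
apply: (inf2.2) => n; apply: (precMl p2 n2); rewrite mulrC divfK //.
apply: prec_trans (ia n) _; rewrite -step mulrC; apply: precM => //.
by rewrite expr2; apply: precM2 (newton_prec n) (prec_refl _); case: (newton_pos n).
Qed.

End Newton.

(** A self-adjoint [a] is, up to sign, the square root of the positive
    element [a^2]. *)
Lemma pos_total a : star a = a -> pos a \/ pos (- a).
Proof.
move=> sa; have [->|a0] := eqVneq a 0; first by left; exact: pos0.
have [|t pt] := pos_sqrt (pos_sqr sa); first by rewrite expf_neq0.
move/eqP; rewrite eqf_sqr => /orP[]/eqP e; first by left; rewrite -e.
by right; rewrite -e.
Qed.

(** By totality the only alternative is [b - a] negative, which gives [prec b a]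
    and then [a = b] by antisymmetry. *)
Lemma prec_subE a b : prec a b -> pos (b - a).
Proof.
move=> ab; have [pa pb] := prec_pos ab.
have [|//|] := @pos_total (b - a); first by rewrite starD starN !pos_star.
rewrite opprB => /(prec_sub pb) ba.
by rewrite (prec_anti ab ba) subrr; exact: pos0.
Qed.

Definition selfadjoint : {pred K} := fun a => star a == a.

Lemma selfadjointE a : (a \in selfadjoint) = (star a == a). Proof. by []. Qed.

Lemma selfadjoint_divring : divring_closed selfadjoint.
Proof.
split; rewrite ?selfadjointE ?star1 // => a b; rewrite !selfadjointE.
  by move=> /eqP sa /eqP sb; rewrite starD starN sa sb.
by move=> /eqP sa /eqP sb; rewrite starM starV sa sb.
Qed.

HB.instance Definition _ :=
  GRing.isDivringClosed.Build K selfadjoint selfadjoint_divring.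

Definition real_part := {a : K | a \in selfadjoint}.
HB.instance Definition _ := SubChoice.on real_part.
HB.instance Definition _ := [SubChoice_isSubIntegralDomain of real_part by <:].
HB.instance Definition _ := [SubIntegralDomain_isSubField of real_part by <:].

Lemma valD (x y : real_part) : val (x + y) = val x + val y.
Proof. exact: rmorphD. Qed.

Lemma valN (x : real_part) : val (- x) = - val x.
Proof. exact: rmorphN. Qed.

Lemma valM (x y : real_part) : val (x * y) = val x * val y.
Proof. exact: rmorphM. Qed.

Lemma star_val (x : real_part) : star (val x) = val x.
Proof. by apply/eqP; exact: valP x. Qed.

Definition rle (x y : real_part) : bool := `[< pos (val y - val x) >].
Definition rlt (x y : real_part) : bool := (y != x) && rle x y.
Definition rnorm (x : real_part) : real_part := if rle 0 x then x else - x.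

Lemma rle0 (x : real_part) : rle 0 x = `[< pos (val x) >].
Proof. by rewrite /rle rmorph0 subr0. Qed.

Lemma rle_add (x y : real_part) : rle 0 x -> rle 0 y -> rle 0 (x + y).
Proof. by rewrite !rle0 rmorphD => /asboolP px /asboolP py; apply/asboolP/posD. Qed.

Lemma rle_mul (x y : real_part) : rle 0 x -> rle 0 y -> rle 0 (x * y).
Proof. by rewrite !rle0 rmorphM => /asboolP px /asboolP py; apply/asboolP/posM. Qed.

Lemma rle_anti (x : real_part) : rle 0 x -> rle x 0 -> x = 0.
Proof.
rewrite rle0 /rle rmorph0 sub0r => /asboolP px /asboolP nx.
by apply: val_inj; rewrite rmorph0; exact: pos_anti.
Qed.

Lemma rle_sub (x y : real_part) : rle 0 (y - x) = rle x y.
Proof. by rewrite rle0 rmorphB. Qed.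

Lemma rle_total (x : real_part) : rle 0 x || rle x 0.
Proof.
rewrite rle0 /rle rmorph0 sub0r; apply/orP.
by case: (pos_total (star_val x)) => h; [left|right]; apply/asboolP.
Qed.

Lemma rnormN (x : real_part) : rnorm (- x) = rnorm x.
Proof.
have e : rle 0 (- x) = rle x 0 by rewrite -[- x]sub0r rle_sub.
rewrite /rnorm e opprK; have := rle_total x.
case: ifP; case: ifP => // a b _.
by rewrite (rle_anti a b) oppr0.
Qed.

Lemma rnorm_id (x : real_part) : rle 0 x -> rnorm x = x.
Proof. by rewrite /rnorm => ->. Qed.

HB.instance Definition _ := Num.IntegralDomain_isLeReal.Build real_part
  rle_add rle_mul rle_anti rle_sub rle_total rnormN rnorm_id
  (fun x y : real_part => erefl (rlt x y)).

Lemma real_part_ge0 (x : real_part) : (0 <= x) = `[< pos (val x) >].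
Proof. exact: rle0. Qed.

Lemma prec_val (x y : real_part) : 0 <= x -> x <= y -> prec (val x) (val y).
Proof. by rewrite real_part_ge0 => /asboolP px /asboolP; exact: prec_sub. Qed.

Lemma real_part_infima : has_decreasing_infima real_part.
Proof.
move=> a l l0 adec la.
have a0 n : 0 <= a n by exact: le_trans (ltW l0) (la n).
have [|n|n|t ta tm] := @prec_inf K (fun n => val (a n)) (val l).
- apply: contraTneq l0 => e; rewrite (_ : l = 0) ?ltxx //.
  by apply: val_inj; rewrite e rmorph0.
- exact: prec_val.
- exact: prec_val (ltW l0) (la n).
have [pt _] := prec_pos (ta 0%N).
have st : t \in selfadjoint by rewrite selfadjointE (pos_star pt).
pose t' : real_part := Sub t st; exists t' => [n|m ma].
  by apply/asboolP; rewrite SubK; exact: prec_subE.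
have [m0|/ltW m0] := leP 0 m; last first.
  by apply: le_trans m0 _; rewrite real_part_ge0 SubK; apply/asboolP.
by apply/asboolP; rewrite SubK; apply: prec_subE; apply: tm => n; exact: prec_val.
Qed.

End StarField.

(** * Classification of the involutive field *)

Lemma inj_surj_bij (A B : Type) (f : A -> B) :
  injective f -> (forall y, exists x, f x = y) -> bijective f.
Proof.
move=> fi fs; have H y := projT2 (cid (fs y)).
by exists (fun y => projT1 (cid (fs y))) => [x|y]; [apply: fi; rewrite H|exact: H].
Qed.

Section Classification.
Variables (K : star_field) (R : realType).
Local Notation star := (@star K).
Local Notation pos := (@pos K).
Local Notation F := (real_part K).
Local Notation Phi := (@cut_sup F R).
Let Finf := @real_part_infima K.

(** The real part of [a]; the default value 0 is never reached, as
    [(a + a†) / 2] is self-adjoint. *)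
Definition half_trace (a : K) : F := insubd 0 ((a + star a) / 2%:R).

Lemma half_traceE a : val (half_trace a) = (a + star a) / 2%:R.
Proof.
rewrite val_insubd ifT // selfadjointE starM starV starD starK addrC.
by rewrite (pos_star (pos_nat K 2)).
Qed.

Lemma half_trace_sa a : star a = a -> val (half_trace a) = a.
Proof.
by move=> sa; rewrite half_traceE sa -mulr2n -[a *+ 2]mulr_natr mulfK // natr_neq0.
Qed.

Lemma half_trace_val (x : F) : half_trace (val x) = x.
Proof. by apply: val_inj; rewrite half_trace_sa // star_val. Qed.

Lemma half_traceD a b : half_trace (a + b) = half_trace a + half_trace b.
Proof.
apply: val_inj; rewrite rmorphD /= !half_traceE starD -mulrDl; congr (_ / _).
by ring.
Qed.

Lemma pos_half_trace a : star a = a -> pos a <-> 0 <= Phi (half_trace a).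
Proof.
move=> sa; rewrite (cut_sup_ge0 Finf) real_part_ge0 half_trace_sa //.
by split=> /asboolP.
Qed.

Lemma trivial_involution : (forall a, star a = a) -> exists phi : K -> R,
  [/\ bijective phi, {morph phi : a b / a + b}, {morph phi : a b / a * b},
      phi 1 = 1 & (forall a, phi (star a) = phi a) /\ forall a, pos a <-> 0 <= phi a].
Proof.
move=> sa; exists (fun a => Phi (half_trace a)); split.
- apply: inj_surj_bij => [a b /(cut_sup_inj Finf) e|r].
    by rewrite -[a]half_trace_sa // e half_trace_sa.
  have [x <-] := cut_sup_surj Finf r; exists (val x).
  by rewrite half_trace_val.
- by move=> a b; rewrite half_traceD (cut_supD Finf).
- move=> a b; rewrite -(cut_supM Finf); congr Phi; apply: val_inj.
  by rewrite rmorphM /= !half_trace_sa.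
- have -> : half_trace 1 = 1 by apply: val_inj; rewrite half_trace_sa ?star1 ?rmorph1.
  by have := cut_sup_rat Finf R 1; rewrite !rmorph1.
- by split=> a; [rewrite sa|exact: pos_half_trace].
Qed.

(** Normalise the anti-self-adjoint [b = a - a†] by the square root of [b† b]. *)
Lemma imaginary_unit a : star a <> a ->
  exists2 j : K, j ^+ 2 = -1 & star j = - j.
Proof.
move=> sa; pose b := a - star a.
have sb : star b = - b by rewrite starD starN starK opprB.
have b0 : b != 0 by rewrite subr_eq0 eq_sym; apply/eqP.
have sbb : star b * b != 0 by rewrite mulf_neq0 ?star_eq0.
have [s ps s2] := pos_sqrt (pos_sq b) sbb.
have s0 : s != 0 by apply: contraNneq sbb => s0; rewrite -s2 s0 expr0n.
exists (b / s); last by rewrite starM starV sb (pos_star ps) mulNr.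
by rewrite exprMn exprVn s2 sb mulNr -expr2 invrN mulrN mulfV // expf_neq0.
Qed.

Lemma nontrivial_involution a0 : star a0 <> a0 -> exists phi : K -> R[i]%C,
  [/\ bijective phi, {morph phi : a b / a + b}, {morph phi : a b / a * b},
      phi 1 = 1 & (forall a, phi (star a) = conjc (phi a)) /\
      forall a, pos a <-> exists2 r, 0 <= r & phi a = (r%:C)%C].
Proof.
move=> /imaginary_unit[j j2 sj].
have n2 : 2%:R != 0 :> K := natr_neq0 K 1.
pose im a := half_trace (- j * a).
have imE a : val (im a) = - j * (a - star a) / 2%:R.
  by rewrite half_traceE starM starN sj; congr (_ / _); ring.
have imD a b : im (a + b) = im a + im b by rewrite /im mulrDr half_traceD.
(* With [half_trace] and [im] as coordinates, the field is [F + j F]. *)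
have decomp a : a = val (half_trace a) + j * val (im a).
  rewrite imE half_traceE.
  have -> : j * (- j * (a - star a) / 2%:R) = - j ^+ 2 * (a - star a) / 2%:R by ring.
  by rewrite j2; field.
have uniq (x y : F) : half_trace (val x + j * val y) = x /\ im (val x + j * val y) = y.
  have e : star (val x + j * val y) = val x - j * val y.
    by rewrite starD starM sj !star_val mulNr.
  split; apply: val_inj; first by rewrite half_traceE e; field.
  rewrite imE e.
  have -> : - j * (val x + j * val y - (val x - j * val y)) / 2%:R = - j ^+ 2 * val y.
    by field.
  by rewrite j2 opprK mul1r.
have mulE a b : half_trace (a * b) = half_trace a * half_trace b - im a * im b /\
    im (a * b) = half_trace a * im b + im a * half_trace b.
  set xa := half_trace a; set ya := im a; set xb := half_trace b; set yb := im b.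
  have <- : val (xa * xb - ya * yb) + j * val (xa * yb + ya * xb) = a * b.
    rewrite (decomp a) (decomp b) -/xa -/xb -/ya -/yb !valD valN !valM.
    transitivity (val xa * val xb + j ^+ 2 * (val ya * val yb) +
      j * (val xa * val yb + val ya * val xb)); last by ring.
    by rewrite j2; ring.
  exact: uniq.
have sa0 a : star a = a -> im a = 0.
  by move=> sa; apply: val_inj; rewrite imE sa subrr mulr0 mul0r rmorph0.
exists (fun a => (Phi (half_trace a) +i* Phi (im a))%C); split.
- apply: inj_surj_bij => [a b|[r s]].
    move=> /eqP; rewrite eq_complex => /andP[/eqP e1 /eqP e2].
    have {}e1 := cut_sup_inj Finf e1; have {}e2 := cut_sup_inj Finf e2.
    by rewrite (decomp a) (decomp b) e1 e2.
  have [x <-] := cut_sup_surj Finf r; have [y <-] := cut_sup_surj Finf s.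
  by exists (val x + j * val y); have [-> ->] := uniq x y.
- by move=> a b; rewrite half_traceD imD !(cut_supD Finf).
- move=> a b; have [-> ->] := mulE a b.
  by rewrite !(cut_supD Finf) (cut_supN Finf) !(cut_supM Finf).
- have := uniq 1 0; rewrite rmorph1 rmorph0 mulr0 addr0 => -[-> ->].
  by rewrite (cut_sup0 Finf); have := cut_sup_rat Finf R 1; rewrite !rmorph1 => ->.
split=> a.
  have e : star a = val (half_trace a) + j * val (- im a).
    by rewrite valN imE half_traceE; transitivity
      ((a + star a) / 2%:R + j ^+ 2 * (a - star a) / 2%:R); [rewrite j2|]; field.
  by have := uniq (half_trace a) (- im a); rewrite -e => -[-> ->]; rewrite (cut_supN Finf).
split=> [pa|[r r0 [er ei]]].
  have sa := pos_star pa; exists (Phi (half_trace a)); first exact/pos_half_trace.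
  by rewrite sa0 // (cut_sup0 Finf).
have ia : im a = 0 by apply: (cut_sup_inj Finf (R := R)); rewrite ei (cut_sup0 Finf).
have sa : star a = a by rewrite (decomp a) ia rmorph0 mulr0 addr0 star_val.
by apply/pos_half_trace => //; rewrite er.
Qed.

End Classification.

(** * The scalars of the localisation *)

Definition scalar_star_field (D : dagger_rig) (ax : rig_axioms D) : star_field :=
  @StarField (scalars ax) (@conj_scalar D ax) (@positive D ax) (@dominated D ax)
    (@conj_scalarD D ax) (@conj_scalarM D ax) (@conj_scalarK D ax)
    (@positive_star D ax) (@positive_sq D ax) (@positive_add D ax)
    (@positive_mul D ax) (@positive_anti D ax) (@dominated_positive D ax)
    (@dominated_trans D ax) (@dominated_anti D ax) (@dominated_add D ax)
    (@dominatedD D ax) (@dominatedM D ax) (@dominated_inf D ax).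

Theorem corollary33 (D : dagger_rig) (ax : rig_axioms D) (R : realType) :
  (exists phi : scalars ax -> R,
      involutive_field_iso R id phi /\
      (phi @` positive_scalars ax)%classic = [set r : R | (0 <= r)%R]%classic) \/
  (exists phi : scalars ax -> R[i]%C,
      involutive_field_iso R[i]%C conjc phi /\
      (phi @` positive_scalars ax)%classic =
        [set (r%:C)%C | r in [set r : R | (0 <= r)%R]]%classic).
Proof.
pose K := scalar_star_field ax.
have [sa|/existsNP[a sa]] := pselect (forall a : K, star a = a).
  have [phi [bij pD pM p1 [ps p]]] := trivial_involution R sa.
  left; exists phi; split; first by split.
  apply/seteqP; split=> [_ [x /p px <-] //|r r0].
  have [g gK Kg] := bij; exists (g r); last exact: Kg.
  by apply/p; rewrite Kg.
have [phi [bij pD pM p1 [ps p]]] := nontrivial_involution R sa.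
right; exists phi; split; first by split.
apply/seteqP; split=> [_ [x /p[r r0 ->] <-]|_ [r r0 <-]]; first by exists r.
have [g gK Kg] := bij; exists (g (r%:C)%C); last exact: Kg.
by apply/p; exists r; rewrite ?Kg.
Qed.
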